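(* There exists a non-empty Zariski open subset $\Delta\subset\mathbb C^2$ such that for every $(d_0,k_0)\in\Delta$ the following hold. There is a set $\Gamma=\{(p_i,q_i,u_i)\}_{i=1,\dots,\delta_1}$ of exactly $\delta_1$ solutions of $\mathfrak S_2(d_0,k_0)$ such that the $q_i$ are pairwise distinct with $\mathcal L(k_0)\cap\mathcal O_{d_0}(\mathcal C)=\{q_1,\dots,q_{\delta_1}\}$ and the $p_i$ are pairwise distinct regular non-ramification points of $\mathcal C$; no point of $\mathcal C$ on the line $y_2=k_0$ is a ramification point; and moreover: (a) if $(p,q,u_0)\in\Gamma$ then $p\in\mathcal C\cap\mathcal S(d_0,k_0)$; (b) if $p\in\mathcal C\cap\mathcal S(d_0,k_0)$ and $p$ is not a ramification point of $\mathcal C$, then there exist $q\in\mathbb C^2$ and $u_0\in\mathbb C$ with $(p,q,u_0)\in\Gamma$.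
   Context: Standing assumptions and notation. $f(y_1,y_2)\in\mathbb C[y_1,y_2]$ is an irreducible polynomial of degree $n$ defining an affine plane curve $\mathcal C\subset\mathbb C^2$; $\mathcal C$ is not a line, and $f$ does not divide $f_1^2+f_2^2$, where $f_i=\partial f/\partial y_i$. Write $\bar y=(y_1,y_2)$, $\bar x=(x_1,x_2)$, and let $d,u$ be further variables. Put $b(\bar y,\bar x,d)=(x_1-y_1)^2+(x_2-y_2)^2-d^2$, $n(\bar y,\bar x)=-f_2(\bar y)(x_1-y_1)+f_1(\bar y)(x_2-y_2)$, $w(\bar y,u)=u(f_1^2(\bar y)+f_2^2(\bar y))-1$. Let $\Omega(d)\subset\mathbb C^6$ be the common zero set of $f,b,n,w$ in the variables $(\bar y,\bar x,d,u)$, and for $d_0\in\mathbb C\setminus\{0\}$ let $I(d_0)=\langle f,b(\bar y,\bar x,d_0),n,w\rangle\subset\mathbb C[\bar y,\bar x,u]$ and $\Omega(d_0)\subset\mathbb C^5$ its zero set. The offset of $\mathcal C$ at distance $d_0$ is $\mathcal O_{d_0}(\mathcal C)$, the Zariski closure of the projection of $\Omega(d_0)$ to the $\bar x$-coordinates; the generic offset $\mathcal O_d(\mathcal C)\subset\mathbb C^3$ is the Zariski closure of the projection of $\Omega(d)$ to the $(\bar x,d)$-coordinates (it is a surface). The generic offset equation $g(x_1,x_2,d)\in\mathbb C[\bar x,d]$ is a square-free polynomial defining the surface $\mathcal O_d(\mathcal C)$, normalized to have no factor of positive degree lying in $\mathbb C[d]$ (it is determined up to a nonzero constant factor). Let $\delta_1=\deg_{x_1}g$.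 For $(d_0,k_0)\in\mathbb C^2$, $\mathcal L(k_0)$ is the line $x_2=k_0$, and $\mathfrak S_2(d_0,k_0)$ is the system $f(\bar y)=0$, $b(\bar y,\bar x,d_0)=0$, $n(\bar y,\bar x)=0$, $w(\bar y,u)=0$, $x_2-k_0=0$ in the unknowns $(\bar y,\bar x,u)\in\mathbb C^5$. A point $p\in\mathcal C$ is a ramification point if $f_2(p)=0$; it is regular if it is a nonsingular point of $\mathcal C$. The auxiliary polynomial is $s(\bar y,d,k)=(f_1^2+f_2^2)(y_2-k)^2-f_2^2d^2$, and $\mathcal S(d_0,k_0)\subset\mathbb C^2$ is the zero set of $s(\bar y,d_0,k_0)$. *)

(* Defs.v *)
From HB Require Import structures.
From mathcomp Require Import all_boot all_order all_algebra.
From mathcomp Require Import complex.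
From mathcomp Require Import reals.
Set Implicit Arguments. Unset Strict Implicit. Unset Printing Implicit Defensive.
Import Order.TTheory GRing.Theory Num.Theory.
Local Open Scope ring_scope.

Section OffsetDefs.
Variable C : fieldType.

(* Bivariate polynomials C[y1,y2] as {poly {poly C}}: outer variable y1,
   inner variable y2.  Trivariate polynomials C[x1,x2,d] as
   {poly {poly {poly C}}}: outer variable x1, then x2, innermost d. *)
Definition ev2 (f : {poly {poly C}}) (y : C * C) : C := (f.[y.1%:P]).[y.2].
Definition ev3 (g : {poly {poly {poly C}}}) (p : C * C * C) : C :=
  ((g.[(p.1.1%:P)%:P]).[p.1.2%:P]).[p.2].

Definition pd1 (f : {poly {poly C}}) : {poly {poly C}} := deriv f.
Definition pd2 (f : {poly {poly C}}) : {poly {poly C}} := map_poly (@deriv C) f.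

Definition pdvd (R : comRingType) (a b : R) : Prop := exists h, b = a * h.

Definition irreducible2 (f : {poly {poly C}}) : Prop :=
  f != 0 /\ f \isn't a GRing.unit /\
  forall a b : {poly {poly C}}, f = a * b -> a \is a GRing.unit \/ b \is a GRing.unit.

Definition curve_not_line (f : {poly {poly C}}) : Prop :=
  ~ exists a b c : C, (a != 0 \/ b != 0) /\
      forall y : C * C, ev2 f y = 0 <-> a * y.1 + b * y.2 + c = 0.

Definition zclosure2 (S : C * C -> Prop) : C * C -> Prop :=
  fun x => forall h : {poly {poly C}}, (forall s, S s -> ev2 h s = 0) -> ev2 h x = 0.
Definition zclosure3 (S : C * C * C -> Prop) : C * C * C -> Prop :=
  fun x => forall h : {poly {poly {poly C}}}, (forall s, S s -> ev3 h s = 0) -> ev3 h x = 0.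

Definition zopen2 (D : C * C -> Prop) : Prop :=
  exists hs : seq {poly {poly C}}, forall p, D p <-> exists2 h, h \in hs & ev2 h p != 0.

Variable f : {poly {poly C}}.

Definition f1 (y : C * C) : C := ev2 (pd1 f) y.
Definition f2 (y : C * C) : C := ev2 (pd2 f) y.

Definition bfun (y x : C * C) (d : C) : C := (x.1 - y.1) ^+ 2 + (x.2 - y.2) ^+ 2 - d ^+ 2.
Definition nfun (y x : C * C) : C := - f2 y * (x.1 - y.1) + f1 y * (x.2 - y.2).
Definition wfun (y : C * C) (u : C) : C := u * (f1 y ^+ 2 + f2 y ^+ 2) - 1.
Definition sfun (y : C * C) (d k : C) : C :=
  (f1 y ^+ 2 + f2 y ^+ 2) * (y.2 - k) ^+ 2 - f2 y ^+ 2 * d ^+ 2.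

Definition inOmega (y x : C * C) (d u : C) : Prop :=
  ev2 f y = 0 /\ bfun y x d = 0 /\ nfun y x = 0 /\ wfun y u = 0.

Definition offset (d0 : C) : C * C -> Prop :=
  zclosure2 (fun x => exists y u, inOmega y x d0 u).

Definition genOffsetProj : C * C * C -> Prop :=
  fun p => exists y u, inOmega y p.1 p.2 u.

Definition generic_offset_eq (g : {poly {poly {poly C}}}) : Prop :=
  (forall p, ev3 g p = 0 <-> zclosure3 genOffsetProj p) /\
  (forall h, pdvd (h * h) g -> h \is a GRing.unit) /\
  (forall h : {poly C}, (1 < size h)%N -> ~ pdvd ((h%:P)%:P) g).

Definition solS2 (d0 k0 : C) (y x : C * C) (u : C) : Prop :=
  ev2 f y = 0 /\ bfun y x d0 = 0 /\ nfun y x = 0 /\ wfun y u = 0 /\ x.2 - k0 = 0.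

Definition ramification (p : C * C) : Prop := ev2 f p = 0 /\ f2 p = 0.
Definition regular_pt (p : C * C) : Prop := ev2 f p = 0 /\ (f1 p != 0 \/ f2 p != 0).

End OffsetDefs.

(* Main.v *)
Require Import Defs.
From HB Require Import structures.
From mathcomp Require Import all_boot all_order all_algebra.
From mathcomp Require Import all_field.
From mathcomp Require Import boolp.
From mathcomp Require Import ring.
From mathcomp Require Import complex.
From mathcomp Require Import reals.
Set Implicit Arguments. Unset Strict Implicit. Unset Printing Implicit Defensive.
Import Order.TTheory GRing.Theory Num.Theory.
Local Open Scope ring_scope.

(** Away from the ramification points, a point y of the curve satisfies
    s(y, d, k) = 0 exactly when one of its two offset points at distance d lies
    on the line x_2 = k.  It remains to show that for generic (k, d) the roots of
    g(., k, d) are deg_{x_1} g in number, are exactly the first coordinates of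
    these offset points, and each come from a single y.

    - Number of roots: C[x_2, d][x_1] is factorial and g is square-free, so g is
      coprime to its x_1-derivative over C(x_2, d).
    - No spurious root: the projection of Omega(d) is constructible by quantifier
      elimination, so its fibre over a generic (k, d) is the zero set of a
      polynomial b, and a multiple c(k, d) b vanishes on the projection, hence on
      its closure g = 0.
    - Uniqueness of y: write h = f_1^2 + f_2^2 and
      g(x, d) = g_0(x, d^2) + d g_1(x, d^2).  As both signs of d occur,
      g_i(y + t grad f(y), t^2 h(y)) vanishes for all y on the curve and all t.
      Differentiating in t and along the curve shows that, off the focal points,
      grad_x g is parallel to x - y with a factor depending on (x, d) only;
      since g_{x_1} <> 0, this recovers y from (x, d). *)

(** * Factorial domains *)

Section Divisibility.
Variable R : idomainType.
Implicit Types a b c p : R.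

Lemma pdvd_refl a : pdvd a a. Proof. by exists 1; rewrite mulr1. Qed.
Lemma pdvd_trans b a c : pdvd a b -> pdvd b c -> pdvd a c.
Proof. by move=> [x ->] [y ->]; exists (x * y); rewrite mulrA. Qed.
Lemma pdvd_mulr a b c : pdvd a b -> pdvd a (b * c).
Proof. by move=> [x ->]; exists (x * c); rewrite mulrA. Qed.
Lemma pdvd_mull a b c : pdvd a b -> pdvd a (c * b).
Proof. by rewrite mulrC; apply: pdvd_mulr. Qed.
Lemma pdvdD a b c : pdvd a b -> pdvd a c -> pdvd a (b + c).
Proof. by move=> [x ->] [y ->]; exists (x + y); rewrite mulrDr. Qed.
Lemma pdvdN a b : pdvd a b -> pdvd a (- b).
Proof. by move=> [x ->]; exists (- x); rewrite mulrN. Qed.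
Lemma pdvdB a b c : pdvd a b -> pdvd a c -> pdvd a (b - c).
Proof. by move=> ab ac; apply/pdvdD/pdvdN. Qed.

Definition prime_elt p :=
  [/\ p != 0, p \isn't a GRing.unit &
      forall a b, pdvd p (a * b) -> pdvd p a \/ pdvd p b].

(** Existence of factorisations into primes, rather than irreducibles, already forces uniqueness up
    to units. *)
Definition factorial_domain :=
  forall a, a != 0 -> exists u, exists2 s : seq R,
    u \is a GRing.unit /\ (forall p, p \in s -> prime_elt p) & a = u * \prod_(p <- s) p.

Lemma prime_dvd_prod p (s : seq R) : prime_elt p ->
  pdvd p (\prod_(q <- s) q) -> exists2 q, q \in s & pdvd p q.
Proof.
move=> [_ pU pM]; elim: s => [|q s IHs].
  by rewrite big_nil => -[x] /esym px1; case/negP: pU; apply/unitrPr; exists x.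
rewrite big_cons => /pM[pq|/IHs[r rs pr]]; first by exists q; rewrite ?mem_head.
by exists r; rewrite // inE rs orbT.
Qed.

Lemma prime_dvd_unit p u : prime_elt p -> u \is a GRing.unit -> ~ pdvd p u.
Proof.
by move=> [_ pU _] uU [x ux]; move: uU; rewrite ux unitrM (negPf pU).
Qed.

Lemma prime_dvd_prime p q : prime_elt p -> prime_elt q -> pdvd p q ->
  exists2 v, v \is a GRing.unit & q = p * v.
Proof.
move=> [p0 pU pM] [q0 qU qM] [v qE]; exists v => //.
have: pdvd q (p * v) by rewrite -qE; apply: pdvd_refl.
case/qM => -[x xE].
  have/esym xv1 : 1 = v * x.
    by apply: (mulfI p0); rewrite mulr1 mulrA -qE -xE.
  by apply/unitrPr; exists x.
have/esym xv1 : 1 = p * x.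
  have v0: v != 0 by apply: contraNneq q0 => v0; rewrite qE v0 mulr0.
  by apply: (mulfI v0); rewrite mulr1 mulrCA mulrA -qE -xE.
by case/negP: pU; apply/unitrPr; exists x.
Qed.

(** [p] is associate to one prime of the list; that prime is removed and the unit is absorbed. The
    drop in length is what makes the extraction of contents terminate. *)
Lemma factor_cancel p m u (s : seq R) : prime_elt p -> u \is a GRing.unit ->
  (forall q, q \in s -> prime_elt q) -> p * m = u * \prod_(q <- s) q ->
  exists u' (s' : seq R), [/\ u' \is a GRing.unit, (size s' < size s)%N,
    (forall q, q \in s' -> prime_elt q) & m = u' * \prod_(q <- s') q].
Proof.
move=> pp uU sP E.
have: pdvd p (u * \prod_(q <- s) q) by exists m.
have [p0 _ pM] := pp.
case/pM => [/(prime_dvd_unit pp uU)//|/(prime_dvd_prod pp)[q qs pq]].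
have [v vU qE] := prime_dvd_prime pp (sP _ qs) pq.
exists (u * v), (rem q s); split.
- by rewrite unitrM uU.
- by rewrite size_rem // prednK //; case: (s) qs.
- by move=> r /mem_rem; apply: sP.
apply: (mulfI p0); rewrite E (perm_big _ (perm_to_rem qs)) big_cons /= qE.
by rewrite !mulrA (mulrC u p).
Qed.

End Divisibility.

Lemma factorial_field (F : fieldType) : factorial_domain F.
Proof.
move=> a a0; exists a, [::]; last by rewrite big_nil mulr1.
by split=> //; rewrite unitfE.
Qed.

(** * Gauss's lemma and factoriality of polynomial rings *)

Section PolyFactorial.
Variable R : idomainType.
Implicit Types (c : R) (p q a b : {poly R}).

Lemma pdvd_polyCP c p : pdvd c%:P p <-> forall i, pdvd c p`_i.
Proof.
split=> [[q ->] i|cp]; first by exists q`_i; rewrite coefCM.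
have [q qE] := choice cp.
exists (\poly_(i < size p) q i); apply/polyP => i; rewrite coefCM coef_poly.
by case: ltnP => [_|/leq_sizeP->//]; rewrite ?qE // mulr0.
Qed.

(** Induction on the sum of the sizes: [c] divides the product of the leading coefficients, hence
    one of them, and that leading term can be stripped off. *)
Lemma prime_polyC c : prime_elt c -> prime_elt c%:P.
Proof.
move=> [c0 cU cM]; split; first by rewrite polyC_eq0.
  by rewrite poly_unitE size_polyC c0 coefC.
have dX (q : {poly R}) n : pdvd c q`_n -> pdvd c%:P (q`_n *: 'X^n).
  move=> cq; apply/pdvd_polyCP => i; rewrite coefZ; exact: pdvd_mulr.
have split_top n (q : {poly R}) : (size q <= n.+1)%N ->
    exists2 r : {poly R}, (size r <= n)%N & q = r + q`_n *: 'X^n.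
  move=> sq; exists (take_poly n q); first exact: size_take_poly.
  apply/polyP => i; rewrite coefD coef_take_poly coefZ coefXn.
  case: ltngtP => [_|ni|->]; rewrite ?mulr0 ?addr0 ?mulr1 ?add0r //.
  by apply/leq_sizeP/ni.
move=> a b; have [n] := ubnP (size a + size b).
elim: n a b => // n IHn a b sab cab.
have [a0|a_gt0] := posnP (size a).
  by left; move/eqP: a0; rewrite size_poly_eq0 => /eqP->; exists 0; rewrite mulr0.
have [b0|b_gt0] := posnP (size b).
  by right; move/eqP: b0; rewrite size_poly_eq0 => /eqP->; exists 0; rewrite mulr0.
have [sa sb] := (prednK a_gt0, prednK b_gt0).
have [a' sa' aE] := split_top _ a (eq_leq (esym sa)).
have [b' sb' bE] := split_top _ b (eq_leq (esym sb)).
(* Sizes exceed degrees by one, so this index is the top degree of [a * b]. *)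
have := (pdvd_polyCP _ _).1 cab (size a + size b).-2.
rewrite -mul_lead_coef.
case/cM => cl.
- have ca := dX a (size a).-1 cl.
  have : pdvd c%:P (a' * b).
    rewrite (_ : a' = a - a`_(size a).-1 *: 'X^((size a).-1)); last by rewrite {1}aE addrK.
    by rewrite mulrBl; apply: pdvdB => //; apply: pdvd_mulr.
  case/IHn => [|ca'|cb]; last by right.
    by rewrite (leq_trans (_ : _ < size a + size b)%N) // -{1}sa addSn ltnS leq_add2r.
  by left; rewrite aE; apply: pdvdD.
- have cb := dX b (size b).-1 cl.
  have : pdvd c%:P (a * b').
    rewrite (_ : b' = b - b`_(size b).-1 *: 'X^((size b).-1)); last by rewrite {1}bE addrK.
    by rewrite mulrBr; apply: pdvdB => //; apply: pdvd_mull.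
  case/IHn => [|ca|cb']; [|by left|].
    by apply: (@leq_trans (size a + size b)%N) => //; rewrite -{1}sb addnS ltnS leq_add2l.
  by right; rewrite bE; apply: pdvdD.
Qed.

(** Only prime constants are tested. Over a field there are none, so every polynomial is primitive
    there. *)
Definition primitive q := forall c, prime_elt c -> ~ pdvd c%:P q.

Hypothesis R_fact : factorial_domain R.

(** A prime constant dividing [q] divides its leading coefficient, whose factorisation shortens at
    each division, so the extraction stops. *)
Lemma content_primitive q : q != 0 ->
  exists c q0, [/\ c != 0, primitive q0 & q = c%:P * q0].
Proof.
rewrite -lead_coef_eq0 => /R_fact[u [s [uU sP] lE]].
have [n] := ubnP (size s); elim: n q u s uU sP lE => // n IHn q u s uU sP lE sn.
have [qP|] := EM (primitive q); first by exists 1, q; rewrite mul1r oner_neq0.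
move=> /existsNP[c /not_implyP[cP /contrapT[q' qE]]].
have [c0 _ _] := cP.
have lE' : c * lead_coef q' = u * \prod_(p <- s) p.
  by rewrite -lE qE lead_coefM lead_coefC.
have [u' [s' [u'U ss' s'P l'E]]] := factor_cancel cP uU sP lE'.
have [|d [q0 [d0 q0P q'E]]] := IHn _ _ _ u'U s'P l'E.
  by apply: leq_trans ss' _; rewrite -ltnS.
by exists (c * d), q0; rewrite mulf_neq0 // qE q'E polyCM mulrA.
Qed.

(** The primes of [c] stay prime as constant polynomials and cannot divide [q]; they divide the
    cofactor and cancel one by one. *)
Lemma primitive_dvd q c b : primitive q -> c != 0 -> pdvd q (c%:P * b) -> pdvd q b.
Proof.
move=> qP /R_fact[u [s [uU sP] ->]] [r].
elim: s sP u uU r => [|p s IHs] sP u uU r.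
  rewrite big_nil mulr1 => E; exists ((u^-1)%:P * r).
  by rewrite mulrCA -E mulrA -polyCM mulVr // mul1r.
rewrite big_cons mulrCA polyCM -mulrA => E.
have pP : prime_elt p by apply: sP; rewrite mem_head.
have [p0 _ _] := pP; have [pP0 _ pM] := prime_polyC pP.
have : pdvd p%:P (q * r) by rewrite -E; exists ((u * \prod_(p <- s) p)%:P * b).
case/pM => [/(qP _ pP)//|[r' rE]]; apply: (IHs _ u uU r').
  by move=> x xs; apply: sP; rewrite inE xs orbT.
by apply: (mulfI pP0); rewrite E rE mulrCA.
Qed.

Lemma pdvd_dvdp p q : pdvd p q -> p %| q.
Proof.
move=> [r ->]; apply/Pdiv.WeakIdomain.dvdpP; exists (1, r); rewrite ?oner_neq0 //.
by rewrite scale1r mulrC.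
Qed.

(** [%|] is divisibility up to a nonzero constant, that is, over the fraction field; Gauss's lemma
    removes the constant. *)
Lemma primitive_dvdp q b : primitive q -> q %| b -> pdvd q b.
Proof.
move=> qP /Pdiv.WeakIdomain.dvdpP[[c r] /= c0 E].
by apply: (primitive_dvd qP c0); rewrite mul_polyC E; exists r; rewrite mulrC.
Qed.

Lemma primitive_const_unit q : primitive q -> size q = 1%N -> q \is a GRing.unit.
Proof.
move=> qP /eqP/size_poly1P[e e0 qE]; move: qP; rewrite qE.
have [u [s [uU sP] ->]] := R_fact e0.
case: s sP => [|p s] sP qP; first by rewrite big_nil mulr1 rmorph_unit.
case: (qP p); first by apply: sP; rewrite mem_head.
by exists (u * \prod_(p <- s) p)%:P; rewrite -polyCM big_cons mulrCA.
Qed.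

(** Take the gcd of [q] and [a] over the fraction field. If it is constant, [q] divides [b].
    Otherwise its primitive part divides [q] with a cofactor that [irr] makes constant, hence a
    unit, so [q] divides [a]. *)
Lemma primitive_prime q : primitive q -> (1 < size q)%N ->
  (forall a b, q = a * b -> (size a < size q)%N -> (size b < size q)%N -> False) ->
  prime_elt q.
Proof.
move=> qP sq irr.
have q0 : q != 0 by rewrite -size_poly_gt0 ltnW.
split=> // [|a b qab].
  by rewrite poly_unitE; case: eqP sq => // ->.
have [cop|ncop] := boolP (coprimep q a).
  by right; apply: primitive_dvdp => //; rewrite -(Gauss_dvdpr _ cop); apply: pdvd_dvdp.
left; set e := gcdp q a in ncop *.
have e0 : e != 0 by rewrite gcdp_eq0 negb_and q0.
have [c [e' [c0 e'P eE]]] := content_primitive e0.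
have se : size e = size e' by rewrite eE mul_polyC size_scale.
have e'e : e' %| e by apply: pdvd_dvdp; exists c%:P; rewrite mulrC.
have [m qE] : pdvd e' q by apply: primitive_dvdp => //; apply: (dvdp_trans e'e); apply: dvdp_gcdl.
have e'a : pdvd e' a by apply: primitive_dvdp => //; apply: (dvdp_trans e'e); apply: dvdp_gcdr.
have m0 : m != 0 by apply: contraNneq q0 => m0; rewrite qE m0 mulr0.
have e'0 : e' != 0 by rewrite -size_poly_gt0 -se size_poly_gt0.
have se1 : (1 < size e')%N.
  by rewrite ltn_neqAle -se size_poly_gt0 e0 andbT eq_sym.
have sm : size m = 1%N.
  apply/eqP; rewrite eqn_leq size_poly_gt0 m0 andbT leqNgt; apply/negP => sm.
  have E := size_mul e'0 m0; rewrite -qE in E.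
  apply: (irr e' m qE); rewrite E.
    by rewrite -(prednK (ltnW sm)) addnS /= -[X in (X < _)%N]addn0 ltn_add2l -ltnS prednK // ltnW.
  by rewrite -(prednK (ltnW se1)) addSn /= -[X in (X < _)%N]add0n ltn_add2r -ltnS prednK // ltnW.
have mU : m \is a GRing.unit.
  apply: primitive_const_unit => // d dP dm; apply: (qP d dP); rewrite qE; exact: pdvd_mull.
apply: pdvd_trans e'a; exists m^-1; by rewrite qE mulrK.
Qed.

(** The content is factored in [R]; the primitive part is split, by induction on size, until no
    factorisation into smaller sizes remains. *)
Lemma factorial_poly : factorial_domain {poly R}.
Proof.
move=> q; have [n] := ubnP (size q); elim: n q => // n IHn q sq q0.
have [c [q' [c0 q'P qE]]] := content_primitive q0.
have [u [s [uU sP] cE]] := R_fact c0.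
have q'0 : q' != 0 by apply: contraNneq q0 => m0; rewrite qE m0 mulr0.
have sq' : size q = size q' by rewrite qE mul_polyC size_scale.
suff [v [t [vU tP] q'E]] : exists v, exists2 t : seq {poly R},
    v \is a GRing.unit /\ (forall p, p \in t -> prime_elt p) & q' = v * \prod_(p <- t) p.
  exists (u%:P * v), (map polyC s ++ t); last first.
    rewrite big_cat big_map /= qE q'E cE polyCM rmorph_prod /= -!mulrA.
    by congr (_ * _); rewrite mulrCA.
  split; first by rewrite unitrM vU rmorph_unit.
  move=> p; rewrite mem_cat => /orP[/mapP[d ds ->]|]; last exact: tP.
  exact/prime_polyC/sP.
have [s1|s1] := leqP (size q') 1.
  exists q', [::]; last by rewrite big_nil mulr1.
  split=> //; apply: primitive_const_unit => //.
  by apply/eqP; rewrite eqn_leq s1 size_poly_gt0.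
have [irr|] := EM (forall a b, q' = a * b ->
    (size a < size q')%N -> (size b < size q')%N -> False).
  exists 1, [:: q']; last by rewrite big_seq1 mul1r.
  split=> [|p]; first exact: unitr1.
  rewrite inE => /eqP->; exact: primitive_prime.
move=> /existsNP[a /existsNP[b /not_implyP[abE /not_implyP[sa /not_implyP[sb _]]]]].
have a0 : a != 0 by apply: contraNneq q'0 => m0; rewrite abE m0 mul0r.
have b0 : b != 0 by apply: contraNneq q'0 => m0; rewrite abE m0 mulr0.
have [|v1 [t1 [v1U t1P] E1]] := IHn a _ a0.
  by apply: leq_trans sa _; rewrite -sq' -ltnS.
have [|v2 [t2 [v2U t2P] E2]] := IHn b _ b0.
  by apply: leq_trans sb _; rewrite -sq' -ltnS.
exists (v1 * v2), (t1 ++ t2); last by rewrite abE E1 E2 big_cat /= mulrACA.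
split; first by rewrite unitrM v1U.
by move=> p; rewrite mem_cat => /orP[]; [apply: t1P|apply: t2P].
Qed.

Lemma prime_pdvd_scale p q c : prime_elt p -> (1 < size p)%N -> c != 0 ->
  pdvd p (c%:P * q) -> pdvd p q.
Proof.
move=> [p0 _ pM] sp c0 /pM[[r cE]|//].
have: size (c%:P) = size (p * r) by rewrite cE.
have r0 : r != 0 by apply: contraNneq c0 => r0; rewrite -polyC_eq0 cE r0 mulr0.
rewrite size_polyC c0 size_mul //; move: sp r0; rewrite -size_poly_gt0.
by case: (size p) (size r) => [|[|m]] // [|k] //= _ _; rewrite addSn addnS.
Qed.

Lemma prime_dvdp p q e : prime_elt p -> (1 < size p)%N -> pdvd p e -> e %| q -> pdvd p q.
Proof.
move=> pP sp pe /Pdiv.WeakIdomain.dvdpP[[c r] /= c0 E].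
by apply: (@prime_pdvd_scale _ _ c) => //; rewrite mul_polyC E; apply: pdvd_mull.
Qed.

(** The gcd has positive degree, so one of its prime factors is nonconstant; for such a prime,
    divisibility up to a constant is genuine. *)
Lemma common_prime_factor p q : p != 0 -> ~~ coprimep p q ->
  exists r : {poly R}, [/\ prime_elt r, (1 < size r)%N, pdvd r p & pdvd r q].
Proof.
move=> p0 ncop; set e := gcdp p q in ncop *.
have e0 : e != 0 by rewrite gcdp_eq0 negb_and p0.
have [u [s [uU sP] eE]] := factorial_poly e0.
have [/allP s1|/allPn[r rs]] := boolP (all (fun r : {poly R} => (size r <= 1)%N) s).
  case/negP: ncop; rewrite /coprimep -/e eqn_leq size_poly_gt0 e0 andbT eE.
  have : (size (u : {poly R}) <= 1)%N by move: uU; rewrite poly_unitE => /andP[/eqP->].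
  elim: s s1 (u) {sP eE uU} => [|r s IHs] s1 v sv; first by rewrite big_nil mulr1.
  rewrite big_cons mulrA; apply: IHs.
    by move=> x xs; apply: s1; rewrite inE xs orbT.
  have sr := s1 r (mem_head _ _).
  by rewrite (size1_polyC sv) (size1_polyC sr) -polyCM size_polyC_leq1.
rewrite -ltnNge => sr; exists r.
have re : pdvd r e by rewrite eE (perm_big _ (perm_to_rem rs)) big_cons mulrCA; apply/pdvd_mulr/pdvd_refl.
split=> //; first exact: sP.
  exact: prime_dvdp (sP _ rs) sr re (dvdp_gcdl _ _).
exact: prime_dvdp (sP _ rs) sr re (dvdp_gcdr _ _).
Qed.

(** Bezout over the fraction field with denominators cleared. When [R] is a ring of polynomials in
    parameters, [c] becomes a genericity condition. *)
Lemma coprimep_bezout p q : coprimep p q ->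
  exists u v (c : R), c != 0 /\ u * p + v * q = c%:P.
Proof.
case/Bezout_coprimepP=> -[u v] /= /eqpP[[c1 c2] /= /andP[c10 c20] E].
exists (c1 *: u), (c1 *: v), c2; split=> //.
by rewrite -!scalerAl -scalerDr E alg_polyC.
Qed.

Lemma prime_coprimep p q : prime_elt p -> (1 < size p)%N -> ~ pdvd p q -> coprimep p q.
Proof.
move=> pP sp pq; apply/negPn/negP => ncop; apply: pq.
have [p0 _ _] := pP.
have [r [rP sr rp rq]] := common_prime_factor p0 ncop.
have [v vU pE] := prime_dvd_prime rP pP rp.
apply: pdvd_trans rq; by exists v^-1; rewrite pE mulrK.
Qed.

End PolyFactorial.

(** Irreducibility makes all but one prime of the factorisation collapse into a unit. *)
Lemma irreducible_prime (R : idomainType) (f : R) : factorial_domain R ->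
  f != 0 -> f \isn't a GRing.unit ->
  (forall a b, f = a * b -> a \is a GRing.unit \/ b \is a GRing.unit) ->
  prime_elt f.
Proof.
move=> Rf f0 fU irr; have [u [s [uU sP] fE]] := Rf f f0.
case: s sP fE => [|p s] sP; first by rewrite big_nil mulr1 => fE; rewrite fE uU in fU.
have pP : prime_elt p by apply: sP; rewrite mem_head.
have [p0 pU pM] := pP.
rewrite big_cons mulrCA; set v := u * _ => fE.
case: (irr _ _ fE) => [|vU]; first by rewrite (negPf pU).
split=> // a b fab.
have fd c : pdvd p c -> pdvd f c.
  by apply: pdvd_trans; exists v^-1; rewrite fE mulrK.
have: pdvd p (a * b) by apply: pdvd_trans fab; exists v.
by case/pM => /fd; [left|right].
Qed.

(** * Generic behaviour of definable sets *)

Section Generic.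
Variable C : numClosedFieldType.
Implicit Types (k d x : C) (c : {poly {poly C}}) (b : {poly {poly {poly C}}}).

(** Bundles [ev2] as a ring morphism, so that the generic morphism lemmas apply to it. *)
Definition ev2h (y : C * C) : {rmorphism {poly {poly C}} -> C} :=
  horner_eval y.2 \o horner_eval y.1%:P.

Lemma ev2hE y c : ev2 c y = ev2h y c. Proof. by []. Qed.

Definition spec b k d : {poly C} := map_poly (ev2h (k, d)) b.

Lemma ev3E b x k d : ev3 b (x, k, d) = (spec b k d).[x].
Proof.
rewrite /spec -[x in RHS](_ : ev2h (k, d) x%:P%:P = x) ?horner_map //.
by rewrite /= /horner_eval !hornerC.
Qed.

Lemma ev2E c k d : ev2 c (k, d) = (map_poly (horner_eval d) c).[k].
Proof.
rewrite -[k in RHS](_ : horner_eval d k%:P = k) ?horner_map //.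
by rewrite /= /horner_eval hornerC.
Qed.

Lemma poly_nonroot (p : {poly C}) : p != 0 -> exists x, p.[x] != 0.
Proof. by move=> /closed_nonrootP[x]; exists x. Qed.

Lemma poly_vanish (p : {poly C}) : (forall x, p.[x] = 0) -> p = 0.
Proof.
by move=> p0; apply/eqP; apply: contraT => /poly_nonroot[x]; rewrite p0 eqxx.
Qed.

Lemma poly_vanish_except (p q : {poly C}) : q != 0 ->
  (forall x, q.[x] != 0 -> p.[x] = 0) -> p = 0.
Proof.
move=> q0 pq; suff /eqP : p * q = 0 by rewrite mulf_eq0 (negPf q0) orbF => /eqP.
apply: poly_vanish => x; rewrite hornerM.
by have [->|/pq->] := eqVneq q.[x] 0; rewrite ?mulr0 ?mul0r.
Qed.

Lemma poly2_nonroot c : c != 0 -> exists k d, ev2 c (k, d) != 0.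
Proof.
rewrite -lead_coef_eq0 => /poly_nonroot[d ld].
have /poly_nonroot[k] : map_poly (horner_eval d) c != 0.
  by apply: contraNneq ld => /(congr1 (fun p : {poly C} => p`_(size c).-1)); rewrite coef_map coef0 => /= <-.
by rewrite -ev2E; exists k, d.
Qed.

(** * Properties holding on a non-empty principal open set of the plane *)

Definition gen2 (P : C -> C -> Prop) : Prop :=
  exists2 c, c != 0 & forall k d, ev2 c (k, d) != 0 -> P k d.

Lemma gen2W (P Q : C -> C -> Prop) : (forall k d, P k d -> Q k d) -> gen2 P -> gen2 Q.
Proof. by move=> PQ [c c0 cP]; exists c => // k d /cP/PQ. Qed.

Lemma gen2T (P : C -> C -> Prop) : (forall k d, P k d) -> gen2 P.
Proof. by move=> PP; exists 1; rewrite ?oner_neq0. Qed.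

Lemma gen2I (P Q : C -> C -> Prop) : gen2 P -> gen2 Q -> gen2 (fun k d => P k d /\ Q k d).
Proof.
move=> [c c0 cP] [c' c'0 cQ]; exists (c * c'); first exact: mulf_neq0.
move=> k d; rewrite ev2hE rmorphM mulf_eq0 negb_or => /andP[ck c'k].
by split; [apply: cP|apply: cQ].
Qed.

Lemma gen2_ex (P : C -> C -> Prop) : gen2 P -> exists k d, P k d.
Proof. by move=> [c /poly2_nonroot[k [d ckd]] /(_ _ _ ckd)]; exists k, d. Qed.

Lemma gen2_neq0 c : c != 0 -> gen2 (fun k d => ev2 c (k, d) != 0).
Proof. by exists c. Qed.

Lemma gen2_size b : gen2 (fun k d => size (spec b k d) = size b).
Proof.
have [->|b0] := eqVneq b 0; first by apply: gen2T => k d; rewrite /spec rmorph0 !size_poly0.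
apply: gen2W (gen2_neq0 (_ : lead_coef b != 0)); last by rewrite lead_coef_eq0.
by move=> k d lb; rewrite /spec size_map_poly_id0.
Qed.

Lemma gen2_spec_neq0 b : b != 0 -> gen2 (fun k d => spec b k d != 0).
Proof.
move=> b0; apply: gen2W (gen2_size b) => k d sE.
by rewrite -size_poly_eq0 sE size_poly_eq0.
Qed.

Lemma gen2_bezout b b' : coprimep b b' ->
  gen2 (fun k d => forall x, ev3 b (x, k, d) = 0 -> ev3 b' (x, k, d) != 0).
Proof.
move=> /(coprimep_bezout)[u [v [c [c0 E]]]].
apply: gen2W (gen2_neq0 c0) => k d ck x b0; apply: contraNneq ck => b'0.
have : ev3 (u * b + v * b') (x, k, d) = ev2 c (k, d).
  by rewrite ev3E E /spec map_polyC hornerC.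
by move: b0 b'0; rewrite !ev3E /spec rmorphD !rmorphM /= hornerD !hornerM => -> -> <-; rewrite !mulr0 addr0.
Qed.

Lemma ev3M b b' p : ev3 (b * b') p = ev3 b p * ev3 b' p.
Proof. by case: p => -[x k] d; rewrite !ev3E /spec rmorphM hornerM. Qed.

Lemma ev3D b b' p : ev3 (b + b') p = ev3 b p + ev3 b' p.
Proof. by case: p => -[x k] d; rewrite !ev3E /spec rmorphD hornerD. Qed.

Lemma ev3C c x k d : ev3 c%:P (x, k, d) = ev2 c (k, d).
Proof. by rewrite ev3E /spec map_polyC hornerC. Qed.

Lemma gen2_dvdp b b' : b %| b' ->
  gen2 (fun k d => forall x, ev3 b (x, k, d) = 0 -> ev3 b' (x, k, d) = 0).
Proof.
move=> /Pdiv.WeakIdomain.dvdpP[[c q] /= c0 E].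
apply: gen2W (gen2_neq0 c0) => k d ck x b0; apply: (mulfI ck).
by rewrite mulr0 -(ev3C _ x) -ev3M mul_polyC E ev3M b0 mulr0.
Qed.

(** Outside the zeros of the constants cleared from the Bezout and divisibility relations, the gcd
    specialises to a polynomial with exactly the common zeros. *)
Lemma gen2_gcdp b b' :
  gen2 (fun k d => forall x, ev3 (gcdp b b') (x, k, d) = 0 <->
     ev3 b (x, k, d) = 0 /\ ev3 b' (x, k, d) = 0).
Proof.
have [[u v] /= /eqpP[[c1 c2] /= /andP[c10 c20] E]] := Bezoutp b b'.
apply: gen2W (gen2I (gen2_neq0 c20) (gen2I (gen2_dvdp (dvdp_gcdl b b')) (gen2_dvdp (dvdp_gcdr b b')))).
move=> k d [c2k [gb gb']] x; split=> [g0|[b0 b'0]]; first by split; [apply: gb|apply: gb'].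
apply: (mulfI c2k).
by rewrite mulr0 -(ev3C _ x) -ev3M mul_polyC -E -mul_polyC ev3M ev3D !ev3M b0 b'0 !mulr0 addr0 mulr0.
Qed.

(** Dividing [b] by its gcd with [b'] removes common zeros. A multiple zero may survive in the
    quotient, so this is repeated, by induction on the size of [b]. *)
Lemma gen2_diff b b' : b != 0 -> exists2 e, e != 0 &
  gen2 (fun k d => forall x, ev3 e (x, k, d) = 0 <->
     ev3 b (x, k, d) = 0 /\ ev3 b' (x, k, d) != 0).
Proof.
have [n] := ubnP (size b); elim: n b => // n IHn b sb b0.
have [cop|ncop] := boolP (coprimep b b').
  exists b => //; apply: gen2W (gen2_bezout cop) => k d cop_kd x.
  by split=> [bx|[]//]; split=> //; apply: cop_kd.
have /Pdiv.WeakIdomain.dvdpP[[c q] /= c0 E] := dvdp_gcdl b b'.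
have g0 : gcdp b b' != 0 by rewrite gcdp_eq0 negb_and b0.
have sE : size b = size (q * gcdp b b') by rewrite -E size_scale.
have q0 : q != 0 by apply: contraNneq b0 => q0; rewrite -size_poly_eq0 sE q0 mul0r size_poly0.
have sq : (size q < size b)%N.
  have : (1 < size (gcdp b b'))%N by rewrite ltn_neqAle eq_sym ncop size_poly_gt0.
  by rewrite sE size_mul //; case: (size _) => [|[|m]] // _; rewrite !addnS ltnS leq_addr.
have [e e0 eP] := IHn q (leq_trans sq sb) q0.
exists e => //; apply: gen2W (gen2I (gen2_neq0 c0) (gen2I (gen2_gcdp b b') eP)).
move=> k d [ck [gP qP]] x.
have E' : ev2 c (k, d) * ev3 b (x, k, d) = ev3 q (x, k, d) * ev3 (gcdp b b') (x, k, d).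
  by rewrite -ev3M -E -mul_polyC ev3M ev3C.
split=> [/qP[q_0 b'x]|[bx b'x]].
  by split=> //; apply: (mulfI ck); rewrite E' q_0 mul0r mulr0.
apply/qP; split=> //; move/eqP: E'; rewrite bx mulr0 eq_sym mulf_eq0.
by case/orP=> /eqP // /gP[_ /eqP]; rewrite (negPf b'x).
Qed.

(* The fibre of [E] over a generic [(k, d)] is the zero set of [b], or the
   complement of that zero set. *)
Definition gen3 (E : C -> C -> C -> Prop) : Prop :=
  exists b (s : bool), b != 0 /\ gen2 (fun k d => forall x,
    E x k d <-> (if s then ev3 b (x, k, d) = 0 else ev3 b (x, k, d) != 0)).

Lemma gen3_ext (E E' : C -> C -> C -> Prop) :
  (forall x k d, E x k d <-> E' x k d) -> gen3 E -> gen3 E'.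
Proof.
move=> EE' [b [s [b0 bP]]]; exists b, s; split=> //.
by apply: gen2W bP => k d bkd x; rewrite -EE'.
Qed.

Lemma gen3_not E : gen3 E -> gen3 (fun x k d => ~ E x k d).
Proof.
move=> [b [s [b0 bP]]]; exists b, (~~ s); split=> //.
apply: gen2W bP => k d bkd x; rewrite bkd; case: s {bkd} => /=.
  by split=> [/eqP|/eqP].
by split=> [/negP/negPn/eqP|->]; rewrite ?eqxx.
Qed.

(** Two zero sets give a gcd, a zero set and a complement give [gen2_diff], two complements give a
    product. *)
Lemma gen3_and E E' : gen3 E -> gen3 E' -> gen3 (fun x k d => E x k d /\ E' x k d).
Proof.
move=> [b [s [b0 bP]]] [b' [s' [b'0 b'P]]]; have bb'P := gen2I bP b'P.
case: s s' {bP b'P} bb'P => [] [] bb'P.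
- exists (gcdp b b'), true; split; first by rewrite gcdp_eq0 negb_and b0.
  by apply: gen2W (gen2I bb'P (gen2_gcdp b b')) => k d [[bP b'P] gP] x; rewrite bP b'P gP.
- have [e e0 eP] := gen2_diff b' b0; exists e, true; split=> //.
  by apply: gen2W (gen2I bb'P eP) => k d [[bP b'P] gP] x; rewrite bP b'P gP.
- have [e e0 eP] := gen2_diff b b'0; exists e, true; split=> //.
  apply: gen2W (gen2I bb'P eP) => k d [[bP b'P] gP] x; rewrite bP b'P gP.
  by split=> -[].
- exists (b * b'), false; split; first exact: mulf_neq0.
  apply: gen2W bb'P => k d [bP b'P] x; rewrite bP b'P ev3M mulf_eq0 negb_or.
  by split=> [[-> ->]|/andP[]].
Qed.

Lemma gen3_eq0 b : gen3 (fun x k d => ev3 b (x, k, d) = 0).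
Proof.
have [->|b0] := eqVneq b 0; last by exists b, true; split=> //; apply: gen2T.
(* The full fibre must be written as the complement of the zeros of [1], because [gen3] excludes the
   zero polynomial. *)
exists 1, false; split; first exact: oner_neq0.
apply: gen2T => k d x; have -> : ev3 0 (x, k, d) = 0 by rewrite /ev3 !horner0.
have -> : ev3 1 (x, k, d) = 1 by rewrite /ev3 !hornerC.
by rewrite oner_neq0.
Qed.

Lemma term_poly3 (t : GRing.term C) : GRing.rterm t ->
  exists b, forall x k d, GRing.eval [:: x; k; d] t = ev3 b (x, k, d).
Proof.
elim: t => //=.
- move=> i _.
  (* Variables past the third read the default value 0 of the environment. *)
  exists (if i is 0%N then 'X else if i is 1%N then 'X%:P else if i is 2 then 'X%:P%:P else 0).
  move=> x k d; case: i => [|[|[|i]]]; rewrite /= ?nth_nil /ev3 /=.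
  + by rewrite hornerX !hornerC.
  + by rewrite hornerC hornerX hornerC.
  + by rewrite !hornerC hornerX.
  + by rewrite !horner0.
- by move=> c _; exists c%:P%:P%:P => x k d; rewrite /ev3 !hornerC.
- by move=> n _; exists n%:R => x k d; rewrite ev3E /spec rmorph_nat -polyC_natr hornerC.
- move=> t1 IH1 t2 IH2 /andP[/IH1[b1 E1] /IH2[b2 E2]].
  by exists (b1 + b2) => x k d; rewrite E1 E2 ev3D.
- by move=> t1 IH1 /IH1[b1 E1]; exists (- b1) => x k d; rewrite E1 !ev3E /spec rmorphN hornerN.
- by move=> t1 IH1 n /IH1[b1 E1]; exists (b1 *+ n) => x k d; rewrite E1 !ev3E /spec rmorphMn hornerMn.
- move=> t1 IH1 t2 IH2 /andP[/IH1[b1 E1] /IH2[b2 E2]].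
  by exists (b1 * b2) => x k d; rewrite E1 E2 ev3M.
- by move=> t1 IH1 n /IH1[b1 E1]; exists (b1 ^+ n) => x k d; rewrite E1 !ev3E /spec rmorphXn horner_exp.
Qed.

Lemma qf_gen3 (phi : GRing.formula C) : GRing.qf_form phi -> GRing.rformula phi ->
  gen3 (fun x k d => GRing.qf_eval [:: x; k; d] phi).
Proof.
elim: phi => //=.
- move=> b _ _; exists 1, (~~ b); split; first exact: oner_neq0.
  apply: gen2T => k d x; rewrite !ev3E /spec rmorph1 hornerC.
  by case: b => /=; split=> //; [rewrite oner_neq0|move/eqP; rewrite oner_eq0].
- move=> t1 t2 _ /andP[/term_poly3[b1 E1] /term_poly3[b2 E2]].
  apply: gen3_ext (gen3_eq0 (b1 - b2)) => x k d.
  rewrite E1 E2 !ev3E /spec rmorphB hornerD hornerN; split=> [/eqP|/eqP->].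
    by rewrite subr_eq0.
  by rewrite subrr.
- move=> p IHp q IHq /andP[pq qq] /andP[pr qr].
  apply: gen3_ext (gen3_and (IHp pq pr) (IHq qq qr)) => x k d.
  by split=> /andP.
- move=> p IHp q IHq /andP[pq qq] /andP[pr qr].
  apply: gen3_ext (gen3_not (gen3_and (gen3_not (IHp pq pr)) (gen3_not (IHq qq qr)))) => x k d.
  split=> [H|/orP[h []|h []]//].
  by apply/negPn/negP => /norP[/negP a /negP b]; apply: H.
- move=> p IHp q IHq /andP[pq qq] /andP[pr qr].
  apply: gen3_ext (gen3_not (gen3_and (IHp pq pr) (gen3_not (IHq qq qr)))) => x k d.
  split=> [H|/implyP h [/h]//].
  by apply/implyP => a; apply/negPn/negP => /negP b; apply: H.
- move=> p IHp pq pr; apply: gen3_ext (gen3_not (IHp pq pr)) => x k d.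
  by split=> /negP.
Qed.

(** * Sets definable by first-order formulas *)

Definition definable (S : seq C -> Prop) : Prop :=
  exists2 phi : GRing.formula C, GRing.rformula phi & forall e, GRing.holds e phi <-> S e.

Definition polyfun (F : seq C -> C) : Prop :=
  exists2 t : GRing.term C, GRing.rterm t & forall e, GRing.eval e t = F e.

(** Quantifier elimination over an algebraically closed field reduces the claim to Boolean
    combinations of polynomial equations. *)
Lemma definable_gen3 S : definable S -> gen3 (fun x k d => S [:: x; k; d]).
Proof.
move=> [phi rphi phiP].
have wf := @ClosedFieldQE.wf_ex_elim C.
have vp := ClosedFieldQE.holds_ex_elim (@GRing.solve_monicpoly C).
have /andP[q1 q2] := GRing.quantifier_elim_wf wf rphi.
apply: gen3_ext (qf_gen3 q1 q2) => x k d; rewrite -phiP.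
by split=> /(GRing.quantifier_elim_rformP wf vp _ rphi).
Qed.

Lemma polyfun_nth i : polyfun (fun e => e`_i).
Proof. by exists (GRing.Var C i). Qed.
Lemma polyfun_const (a : C) : polyfun (fun=> a).
Proof. by exists (GRing.Const a). Qed.
Lemma polyfunD F G : polyfun F -> polyfun G -> polyfun (fun e => F e + G e).
Proof.
move=> [s rs sE] [t rt tE]; exists (GRing.Add s t); rewrite /= ?rs // => e.
by rewrite sE tE.
Qed.
Lemma polyfunM F G : polyfun F -> polyfun G -> polyfun (fun e => F e * G e).
Proof.
move=> [s rs sE] [t rt tE]; exists (GRing.Mul s t); rewrite /= ?rs // => e.
by rewrite sE tE.
Qed.
Lemma polyfunN F : polyfun F -> polyfun (fun e => - F e).
Proof. by move=> [s rs sE]; exists (GRing.Opp s); rewrite //= => e; rewrite sE. Qed.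
Lemma polyfunX F n : polyfun F -> polyfun (fun e => F e ^+ n).
Proof. by move=> [s rs sE]; exists (GRing.Exp s n); rewrite //= => e; rewrite sE. Qed.

Lemma polyfun_horner (p : {poly C}) F : polyfun F -> polyfun (fun e => p.[F e]).
Proof.
move=> Fp; elim/poly_ind: p => [|p c [t rt tE]].
  by exists (GRing.Const 0) => // e; rewrite horner0.
have [t' rt' t'E] := polyfunD (polyfunM (ex_intro2 _ _ t rt tE) Fp) (polyfun_const c).
by exists t' => // e; rewrite t'E hornerMXaddC.
Qed.

Lemma polyfun_ev2 c F G : polyfun F -> polyfun G -> polyfun (fun e => ev2 c (F e, G e)).
Proof.
move=> Fp Gp; elim/poly_ind: c => [|p c [t rt tE]].
  by exists (GRing.Const 0) => // e; rewrite /ev2 !horner0.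
have [t' rt' t'E] := polyfunD (polyfunM (ex_intro2 _ _ t rt tE) Fp) (polyfun_horner c Gp).
by exists t' => // e; rewrite t'E /ev2 hornerMXaddC /= hornerD hornerM hornerC.
Qed.

Lemma definable_ext (S T : seq C -> Prop) :
  (forall e, S e <-> T e) -> definable S -> definable T.
Proof. by move=> ST [s rs sE]; exists s => // e; rewrite sE ST. Qed.
Lemma definable_eq0 F : polyfun F -> definable (fun e => F e = 0).
Proof. by move=> [t rt tE]; exists (GRing.Equal t (GRing.Const 0)); rewrite /= ?rt // => e; rewrite tE. Qed.
Lemma definable_and S T : definable S -> definable T -> definable (fun e => S e /\ T e).
Proof.
move=> [s rs sE] [t rt tE]; exists (GRing.And s t); rewrite /= ?rs // => e.
by rewrite sE tE.
Qed.
Lemma definable_not S : definable S -> definable (fun e => ~ S e).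
Proof. by move=> [s rs sE]; exists (GRing.Not s); rewrite //= => e; rewrite sE. Qed.
Lemma definable_ex i S : definable S -> definable (fun e => exists x, S (set_nth 0 e i x)).
Proof.
move=> [s rs sE]; exists (GRing.Exists i s); rewrite //= => e.
by split=> -[x /sE]; exists x.
Qed.

(** As a set of triples, [P] has fibres that are empty or full. The specialised [b] has a nonroot,
    so a zero set must be the empty fibre and a complement the full one. *)
Lemma definable_gen2 (P : C -> C -> Prop) :
  definable (fun e => P e`_1 e`_2) -> gen2 P \/ gen2 (fun k d => ~ P k d).
Proof.
move=> /definable_gen3[b [s [b0 bP]]].
have bP' := gen2I bP (gen2_spec_neq0 b0).
case: s {bP} bP' => bP; [right|left]; apply: gen2W bP => k d /= [bP /poly_nonroot[x]];
  rewrite -ev3E => bx.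
  by move=> /(bP x)/eqP; rewrite (negPf bx).
exact/(bP x).
Qed.

End Generic.

(** * Generic fibres of the offset surface *)

Section GenericOffset.
Variable C : numClosedFieldType.
Implicit Types (k d x : C) (f c : {poly {poly C}}) (g b : {poly {poly {poly C}}}).

Lemma factorial_poly2 : factorial_domain {poly {poly C}}.
Proof. exact/factorial_poly/factorial_poly/factorial_field. Qed.

Lemma factorial_poly1 : factorial_domain {poly C}.
Proof. exact/factorial_poly/factorial_field. Qed.

Lemma deriv_neq0 (R : idomainType) (r : {poly R}) :
  (forall n, n.+1%:R != 0 :> R) -> (1 < size r)%N -> r^`() != 0.
Proof.
move=> charR sr; apply/eqP => /(congr1 (fun p : {poly R} => p`_(size r).-2)).
rewrite coef_deriv coef0 prednK; last by rewrite -subn1 subn_gt0.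
apply/eqP; rewrite -lead_coefE -mulr_natr mulf_neq0 //.
  by rewrite lead_coef_eq0 -size_poly_gt0 ltnW.
by case: (size r) sr => [|[|n]] // _; apply: charR.
Qed.

Lemma ndvd_deriv (R : idomainType) (r : {poly R}) :
  (forall n, n.+1%:R != 0 :> R) -> (1 < size r)%N -> ~ pdvd r r^`().
Proof.
move=> charR sr [q rE]; have r'0 := deriv_neq0 charR sr.
have r0 : r != 0 by rewrite -size_poly_gt0 ltnW.
have q0 : q != 0 by apply: contraNneq r'0 => q0; rewrite rE q0 mulr0.
have := lt_size_deriv r0; rewrite rE size_mul // ltnNge.
by rewrite -(prednK (_ : 0 < size q)%N) ?size_poly_gt0 // addnS leq_addr.
Qed.

Lemma char0_poly1 n : n.+1%:R != 0 :> {poly C}.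
Proof. by rewrite -polyC_natr polyC_eq0 pnatr_eq0. Qed.

Lemma char0_poly2 n : n.+1%:R != 0 :> {poly {poly C}}.
Proof. by rewrite -polyC_natr polyC_eq0 char0_poly1. Qed.

Lemma squarefree_coprimep_deriv g : g != 0 ->
  (forall h, pdvd (h * h) g -> h \is a GRing.unit) -> coprimep g g^`().
Proof.
move=> g0 sqf; apply/negPn/negP => /(common_prime_factor factorial_poly2 g0).
move=> [r [rP sr [m gE]] rg'].
have [r0 /negP rU rM] := rP.
have : pdvd r (r^`() * m).
  rewrite (_ : _ * m = g^`() - r * m^`()); last by rewrite gE derivM addrK.
  by apply: pdvdB => //; apply/pdvd_mulr/pdvd_refl.
case/rM => [/(ndvd_deriv char0_poly2 sr)//|[h mE]].
by apply: rU; apply: sqf; exists h; rewrite gE mE mulrA.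
Qed.

Lemma simple_roots (p : {poly C}) : p != 0 ->
  (forall x, p.[x] = 0 -> p^`().[x] != 0) ->
  exists rs, [/\ uniq rs, size rs = (size p).-1 & forall x, x \in rs <-> p.[x] = 0].
Proof.
move=> p0 simp; have [rs pE] := closed_field_poly_normal p.
have : lead_coef p != 0 by rewrite lead_coef_eq0.
move: (lead_coef p) pE => l pE lp.
have : separable_poly p.
  rewrite unlock /coprimep; apply: contraT => /closed_rootP[x].
  by rewrite root_gcd => /andP[/rootP/simp/negbTE]; rewrite rootE => ->.
rewrite pE unlock coprimepZl // derivZ coprimepZr // => sep.
exists rs; split.
- by rewrite -separable_prod_XsubC unlock.
- by rewrite (size_scale _ lp) (size_prod_XsubC _ id).
- move=> x; rewrite hornerZ; split=> [xrs|/eqP].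
    by apply/eqP; rewrite mulf_eq0 -rootE root_prod_XsubC xrs orbT.
  by rewrite mulf_eq0 (negPf lp) -rootE root_prod_XsubC.
Qed.

(** Simplicity serves twice: it makes the number of roots equal to the degree in [x_1], and it keeps
    the [x_1]-derivative nonzero at each of them, which later recovers the foot point. *)
Lemma gen2_simple_roots g : g != 0 ->
  (forall h, pdvd (h * h) g -> h \is a GRing.unit) ->
  gen2 (fun k d => (forall x, ev3 g (x, k, d) = 0 -> ev3 g^`() (x, k, d) != 0) /\
     exists rs, [/\ uniq rs, size rs = (size g).-1 & forall x, x \in rs <-> ev3 g (x, k, d) = 0]).
Proof.
move=> g0 sqf; have cop := squarefree_coprimep_deriv g0 sqf.
apply: gen2W (gen2I (gen2_bezout cop) (gen2I (gen2_size g) (gen2_spec_neq0 g0))).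
move=> k d [simp [sE sg0]]; split=> //.
have [|rs [rsU rss rsP]] := simple_roots sg0.
  by move=> x; rewrite -ev3E => /simp; rewrite ev3E /spec -deriv_map.
by exists rs; split=> // [|x]; rewrite ?rss ?sE ?ev3E.
Qed.

Lemma generic_offset_eq_neq0 f g : generic_offset_eq f g -> g != 0.
Proof.
move=> [_ [sqf _]]; apply/eqP => g0.
suff : (0 : {poly {poly {poly C}}}) \is a GRing.unit by rewrite unitr0.
by apply: sqf; exists 0; rewrite g0 mulr0.
Qed.

(** Slots 0, 1, 2 hold [x_1], [x_2], [d]; slots 3, 4 hold the foot point and slot 5 holds [u]. *)
Lemma definable_offset f :
  definable (fun e => inOmega f (e`_3, e`_4) (e`_0, e`_1) e`_2 e`_5).
Proof.
rewrite /inOmega /bfun /nfun /wfun /f1 /f2 /=.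
do !apply: definable_and; apply: definable_eq0; 
by do ![exact: polyfun_nth|exact: polyfun_const|exact: polyfun_ev2|apply: polyfunD|apply: polyfunN|apply: polyfunM|apply: polyfunX|apply: polyfun_ev2].
Qed.

Lemma gen2_offset_fibre f g : generic_offset_eq f g ->
  gen2 (fun k d => forall x, ev3 g (x, k, d) = 0 <-> genOffsetProj f (x, k, d)).
Proof.
move=> gP; have g0 := generic_offset_eq_neq0 gP; have [gZ _] := gP.
have Eg p : genOffsetProj f p -> ev3 g p = 0.
  by move=> Ep; apply/gZ => h; apply.
have := definable_gen3 (definable_ex 3 (definable_ex 4 (definable_ex 5 (definable_offset f)))).
move=> [b [[] [b0]]]; last first.
  (* If the fibres were complements, a generic point off the zeros of both [b] and [g] would lie in
     the projection, where [g] vanishes. *)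
  move=> bP; exfalso; have bg0 : b * g != 0 by rewrite mulf_neq0.
  have [k [d [bP' /poly_nonroot[x]]]] := gen2_ex (gen2I bP (gen2_spec_neq0 bg0)).
  rewrite -ev3E ev3M mulf_eq0 negb_or => /andP[/bP'].
  by move=> [y1 [y2 [u Eyu]]]; rewrite Eg ?eqxx //; exists (y1, y2), u.
move=> [c c0 cP]; exists c => // k d ck x; split; last exact: Eg.
(* The factor [c] makes the product vanish also at the points of the projection lying over
   nongeneric [(k, d)]. *)
move=> /gZ/(_ (c%:P * b)); rewrite ev3M ev3C => cb.
suff /(cP _ _ ck)[y1 [y2 [u Eyu]]] : ev3 b (x, k, d) = 0 by exists (y1, y2), u.
apply: (mulfI ck); rewrite mulr0; apply: cb.
move=> [[x' k'] d'] [[y1 y2] [u Eyu]]; rewrite ev3M ev3C.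
have [->|ck'] := eqVneq (ev2 c (k', d')) 0; first by rewrite mul0r.
by rewrite ((cP _ _ ck' x').1 _) ?mulr0 //; exists y1, y2, u.
Qed.

End GenericOffset.

(** * Chain rule for trivariate polynomials *)

Lemma map_polyMXaddC (R S : nzRingType) (D : {additive R -> S}) (p : {poly R}) c :
  map_poly D (p * 'X + c%:P) = map_poly D p * 'X + (D c)%:P.
Proof.
apply/polyP => i; rewrite coef_map !coefD !coefMX !coefC raddfD /=.
by case: i => [|i] /=; rewrite ?coef_map ?raddf0.
Qed.

Lemma deriv_map_additive (R S : nzRingType) (D : {additive R -> S}) (p : {poly R}) :
  (map_poly D p)^`() = map_poly D p^`().
Proof. by apply/polyP => i; rewrite coef_deriv !coef_map coef_deriv raddfMn. Qed.

Lemma horner_mapMXaddC (R A : comNzRingType) (theta : {rmorphism R -> A}) (a : A)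
    (p : {poly R}) c :
  (map_poly theta (p * 'X + c%:P)).[a] = (map_poly theta p).[a] * a + theta c.
Proof. by rewrite map_polyMXaddC hornerMXaddC. Qed.

Section TrivariatePolynomials.
Variable C : numClosedFieldType.
Implicit Types (f c : {poly {poly C}}) (G : {poly {poly {poly C}}}).

Definition td1 G : {poly {poly {poly C}}} := G^`().
Definition td2 G : {poly {poly {poly C}}} := map_poly (@deriv _) G.
Definition td3 G : {poly {poly {poly C}}} := map_poly (map_poly (@deriv C)) G.

Lemma ev2MXaddC c (p : {poly C}) y : ev2 (c * 'X + p%:P) y = ev2 c y * y.1 + p.[y.2].
Proof. by rewrite /ev2 hornerMXaddC hornerD hornerM hornerC. Qed.

Lemma ev3MXaddC G c y : ev3 (G * 'X + c%:P) y = ev3 G y * y.1.1 + ev2 c (y.1.2, y.2).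
Proof. by rewrite /ev3 hornerMXaddC !hornerD !hornerM !hornerC. Qed.

Lemma ev2_0 y : ev2 (0 : {poly {poly C}}) y = 0. Proof. by rewrite /ev2 !horner0. Qed.
Lemma ev3_0 y : ev3 (0 : {poly {poly {poly C}}}) y = 0. Proof. by rewrite /ev3 !horner0. Qed.

Lemma ev3MX G y : ev3 (G * 'X) y = ev3 G y * y.1.1.
Proof. by rewrite -[_ * 'X]addr0 ev3MXaddC ev2_0 addr0. Qed.

Lemma ev2MX c y : ev2 (c * 'X) y = ev2 c y * y.1.
Proof. by rewrite -[_ * 'X]addr0 ev2MXaddC horner0 addr0. Qed.

Section ChainRule.
Variables (A : comNzRingType) (iota : {rmorphism C -> A}) (phi : {rmorphism A -> C}).
Variable delta : A -> C.
Hypothesis phi_iota : forall z, phi (iota z) = z.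
Hypothesis deltaD : forall a b, delta (a + b) = delta a + delta b.
Hypothesis deltaM : forall a b, delta (a * b) = phi a * delta b + phi b * delta a.
Hypothesis delta_iota : forall z, delta (iota z) = 0.
Variables a1 a2 a3 : A.

Definition sub1 : {rmorphism {poly C} -> A} := horner_eval a3 \o map_poly iota.
Definition sub2 : {rmorphism {poly {poly C}} -> A} := horner_eval a2 \o map_poly sub1.
Definition sub3 : {rmorphism {poly {poly {poly C}}} -> A} := horner_eval a1 \o map_poly sub2.

Lemma sub1MXaddC p z : sub1 (p * 'X + z%:P) = sub1 p * a3 + iota z.
Proof. exact: horner_mapMXaddC. Qed.
Lemma sub2MXaddC c p : sub2 (c * 'X + p%:P) = sub2 c * a2 + sub1 p.
Proof. exact: horner_mapMXaddC. Qed.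
Lemma sub3MXaddC G c : sub3 (G * 'X + c%:P) = sub3 G * a1 + sub2 c.
Proof. exact: horner_mapMXaddC. Qed.

Lemma phi_sub1 p : phi (sub1 p) = p.[phi a3].
Proof.
elim/poly_ind: p => [|p z IHp]; first by rewrite !rmorph0 horner0.
by rewrite sub1MXaddC hornerMXaddC rmorphD rmorphM /= IHp phi_iota.
Qed.

Lemma phi_sub2 c : phi (sub2 c) = ev2 c (phi a2, phi a3).
Proof.
elim/poly_ind: c => [|c p IHc]; first by rewrite !rmorph0 ev2_0.
by rewrite sub2MXaddC ev2MXaddC rmorphD rmorphM /= IHc phi_sub1.
Qed.

Lemma phi_sub3 G : phi (sub3 G) = ev3 G (phi a1, phi a2, phi a3).
Proof.
elim/poly_ind: G => [|G c IHG]; first by rewrite !rmorph0 ev3_0.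
by rewrite sub3MXaddC ev3MXaddC rmorphD rmorphM /= IHG phi_sub2.
Qed.

Lemma delta0 : delta 0 = 0.
Proof. by rewrite -(delta_iota 0) rmorph0. Qed.

Lemma delta_sub1 p : delta (sub1 p) = p^`().[phi a3] * delta a3.
Proof.
elim/poly_ind: p => [|p z IHp]; first by rewrite rmorph0 deriv0 horner0 delta0 mul0r.
rewrite sub1MXaddC deltaD deltaM delta_iota IHp phi_sub1 derivMXaddC hornerD hornerMX.
ring.
Qed.

Lemma delta_sub2 c : delta (sub2 c) =
  ev2 (pd1 c) (phi a2, phi a3) * delta a2 + ev2 (pd2 c) (phi a2, phi a3) * delta a3.
Proof.
elim/poly_ind: c => [|c p IHc].
  by rewrite /pd1 /pd2 !rmorph0 deriv0 map_poly0 ev2_0 delta0 !mul0r addr0.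
rewrite sub2MXaddC deltaD deltaM delta_sub1 IHc phi_sub2 /pd1 /pd2 derivMXaddC.
rewrite map_polyMXaddC ev2MXaddC [ev2 (_ + _) _]ev2hE rmorphD -!ev2hE ev2MX /=.
ring.
Qed.

(** [delta] is a derivation at the point [phi] that kills constants. It is kept abstract to serve
    both for differentiation in [t] and for differentiation along the curve. *)
Lemma chain_rule G : let X := (phi a1, phi a2, phi a3) in
  delta (sub3 G) = ev3 (td1 G) X * delta a1 + ev3 (td2 G) X * delta a2
                   + ev3 (td3 G) X * delta a3.
Proof.
move=> X; elim/poly_ind: G => [|G c IHG].
  by rewrite /td1 /td2 /td3 rmorph0 deriv0 !map_poly0 ev3_0 delta0 !mul0r !addr0.
rewrite sub3MXaddC deltaD deltaM delta_sub2 IHG phi_sub3 /td1 /td2 /td3 derivMXaddC.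
rewrite !map_polyMXaddC !ev3MXaddC ev3D ev3MX /=.
rewrite -/(pd1 c) -/(pd2 c) -/X.
ring.
Qed.
End ChainRule.

(** * Splitting by parity in [d]; the last variable of each part stands for [d ^+ 2] *)

Definition even_part G := map_poly (map_poly (@even_poly C)) G.
Definition odd_part G := map_poly (map_poly (@odd_poly C)) G.

Lemma horner_even_odd (p : {poly C}) d :
  p.[d] = (even_poly p).[d ^+ 2] + d * (odd_poly p).[d ^+ 2].
Proof.
by rewrite -{1}(poly_even_odd p) hornerD hornerM !horner_comp hornerXn hornerX mulrC.
Qed.

Lemma ev2_even_odd c k d : ev2 c (k, d) =
  ev2 (map_poly (@even_poly C) c) (k, d ^+ 2) + d * ev2 (map_poly (@odd_poly C) c) (k, d ^+ 2).
Proof.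
elim/poly_ind: c => [|c p IHc]; first by rewrite !map_poly0 !ev2_0 mulr0 addr0.
rewrite !map_polyMXaddC !ev2MXaddC IHc /= [p.[d]]horner_even_odd.
ring.
Qed.

Lemma ev3_even_odd G x k d : ev3 G (x, k, d) =
  ev3 (even_part G) (x, k, d ^+ 2) + d * ev3 (odd_part G) (x, k, d ^+ 2).
Proof.
rewrite /even_part /odd_part; elim/poly_ind: G => [|G c IHG].
  by rewrite !map_poly0 !ev3_0 mulr0 addr0.
rewrite !map_polyMXaddC !ev3MXaddC IHG /= [ev2 c _]ev2_even_odd.
ring.
Qed.

Lemma td1_even G : td1 (even_part G) = even_part (td1 G).
Proof. by rewrite /td1 /even_part deriv_map_additive. Qed.
Lemma td1_odd G : td1 (odd_part G) = odd_part (td1 G).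
Proof. by rewrite /td1 /odd_part deriv_map_additive. Qed.
Lemma td2_even G : td2 (even_part G) = even_part (td2 G).
Proof.
rewrite /td2 /even_part -!map_poly_comp; apply: eq_map_poly => c /=.
by rewrite deriv_map_additive.
Qed.
Lemma td2_odd G : td2 (odd_part G) = odd_part (td2 G).
Proof.
rewrite /td2 /odd_part -!map_poly_comp; apply: eq_map_poly => c /=.
by rewrite deriv_map_additive.
Qed.

(** Conjugating by the exchange of variables lets facts about [deriv] transfer to [pd2]. *)
Lemma pd2_swapXY c : pd2 c = swapXY (swapXY c)^`().
Proof.
apply/polyP => i; apply/polyP => j.
by rewrite coef_swapXY !coef_deriv coef_map coefMn coef_swapXY coef_deriv.
Qed.

Lemma pd2M c c' : pd2 (c * c') = pd2 c * c' + c * pd2 c'.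
Proof. by rewrite !pd2_swapXY rmorphM derivM rmorphD !rmorphM /= !swapXYK. Qed.

Lemma pd2D c c' : pd2 (c + c') = pd2 c + pd2 c'.
Proof. by rewrite /pd2 raddfD. Qed.

End TrivariatePolynomials.

(** * The curve and its normal lines *)

Section Curve.
Variable C : numClosedFieldType.
Implicit Types (f c P Q : {poly {poly C}}) (g G : {poly {poly {poly C}}}).

Definition roots_of (p : {poly C}) : seq C := sval (closed_field_poly_normal p).

Lemma mem_roots_of (p : {poly C}) x : p != 0 -> p.[x] = 0 -> x \in roots_of p.
Proof.
rewrite /roots_of; case: closed_field_poly_normal => rs /= pE p0 /eqP.
rewrite {1}pE hornerZ mulf_eq0 lead_coef_eq0 (negPf p0) /=.
by rewrite -rootE root_prod_XsubC.
Qed.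

(** An irreducible [f] free of [y_1] is univariate over an algebraically closed field, hence of
    degree one, and its curve is a line. *)
Lemma curve_size_gt1 f : irreducible2 f -> curve_not_line f -> (1 < size f)%N.
Proof.
move=> [f0 [fU irr]] nl; rewrite ltnNge; apply/negP => /size1_polyC fE.
move: f0 fU irr nl; rewrite {}fE; set p := f`_0 => p0 pU irr.
apply; have {}p0 : p != 0 by rewrite -polyC_eq0.
have : size p != 1%N.
  apply: contra pU => sp; rewrite rmorph_unit // poly_unitE sp.
  by case/size_poly1P: sp => e e0 ->; rewrite coefC unitfE.
move=> /closed_rootP[a /factor_theorem[q pE]].
have [] := irr q%:P ('X - a%:P)%:P; first by rewrite -polyCM -pE.
  rewrite poly_unitE coefC => /andP[_]; rewrite eqxx poly_unitE => /andP[/size_poly1P[e e0 qE] _].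
  exists 0, 1, (- a); split; first by right; rewrite oner_neq0.
  move=> y; rewrite mul0r add0r mul1r /ev2 hornerC pE qE hornerM hornerXsubC hornerC; split=> [/eqP|->].
    by rewrite mulf_eq0 (negPf e0) => /eqP.
  by rewrite mulr0.
by rewrite poly_unitE coefC eqxx poly_unitE size_XsubC andbF.
Qed.

Lemma ev2_swapXY c y : ev2 (swapXY c) y = ev2 c (y.2, y.1).
Proof. exact: horner2_swapXY. Qed.

Lemma unit_swapXY c : (swapXY c \is a GRing.unit) = (c \is a GRing.unit).
Proof.
have sU c' : c' \is a GRing.unit -> swapXY c' \is a GRing.unit by exact: rmorph_unit.
by apply/idP/idP => [/sU|/sU //]; rewrite swapXYK.
Qed.

Lemma irreducible2_swapXY f : irreducible2 f -> irreducible2 (swapXY f).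
Proof.
move=> [f0 [fU irr]]; split; first by rewrite swapXY_eq0.
split=> [|a b E]; first by rewrite unit_swapXY.
rewrite -(unit_swapXY a) -(unit_swapXY b).
by apply: irr; rewrite -[f]swapXYK E rmorphM.
Qed.

Lemma curve_not_line_swapXY f : curve_not_line f -> curve_not_line (swapXY f).
Proof.
move=> nl [a [b [c [ab abP]]]]; apply: nl; exists b, a, c; split.
  by case: ab; [right|left].
by move=> y; rewrite [b * _ + _]addrC -(abP (y.2, y.1)) ev2_swapXY -surjective_pairing.
Qed.

Variable f : {poly {poly C}}.
Hypothesis f_irr : irreducible2 f.
Hypothesis f_not_line : curve_not_line f.

Let H : {poly {poly C}} := pd1 f ^+ 2 + pd2 f ^+ 2.
Hypothesis f_ndvd : ~ pdvd f H.

Lemma curve_prime : prime_elt f.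
Proof.
case: f_irr => f0 [fU irr].
exact: irreducible_prime (@factorial_poly2 C) f0 fU irr.
Qed.

Let f_size : (1 < size f)%N := curve_size_gt1 f_irr f_not_line.

Lemma curve_not_dvd_pd2 : ~ pdvd f (pd2 f).
Proof.
have s1 := curve_size_gt1 (irreducible2_swapXY f_irr) (curve_not_line_swapXY f_not_line).
move=> [q /(congr1 swapXY)]; rewrite pd2_swapXY swapXYK rmorphM /= => E.
by apply: (ndvd_deriv (@char0_poly1 C) s1); exists (swapXY q).
Qed.

(** Elimination of [y_1]: [p] plays the part of a resultant of [f] and [P]. *)
Lemma curve_bezout P : ~ pdvd f P ->
  exists2 p : {poly C}, p != 0 & forall y, ev2 f y = 0 -> ev2 P y = 0 -> p.[y.2] = 0.
Proof.
move=> /(prime_coprimep (@factorial_poly1 C) curve_prime f_size).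
move=> /coprimep_bezout[u [v [p [p0 E]]]]; exists p => // y fy Py.
have -> : p.[y.2] = ev2 p%:P y by rewrite /ev2 hornerC.
move: fy Py; rewrite -E !ev2hE rmorphD !rmorphM => -> ->.
by rewrite !mulr0 addr0.
Qed.

(** Otherwise [y_2 - a] divides the irreducible [f], which would then not involve [y_1]. *)
Lemma curve_row_neq0 a : map_poly (horner_eval a) f != 0.
Proof.
apply/eqP => fa0; have [_ [_ irr]] := f_irr.
have [q fE] : pdvd ('X - a%:P)%:P f.
  apply/pdvd_polyCP => i; have /eqP := congr1 (fun p : {poly C} => p`_i) fa0.
  rewrite coef_map coef0 => /factor_theorem[q ->]; exists q; exact: mulrC.
case: (irr _ _ fE); first by rewrite poly_unitE coefC eqxx poly_unitE size_XsubC andbF.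
rewrite poly_unitE => /andP[/size_poly1P[e e0 qE] _].
by move: f_size; rewrite fE qE -polyCM size_polyC ltnNge leq_b1.
Qed.

(** Common zeros lie at finitely many heights [y_2], and each horizontal line meets the curve in
    finitely many points. *)
Lemma curve_finite P : ~ pdvd f P ->
  exists s : seq (C * C), forall y, ev2 f y = 0 -> ev2 P y = 0 -> y \in s.
Proof.
move=> /curve_bezout[p p0 pP].
exists [seq (x, a) | a <- roots_of p, x <- roots_of (map_poly (horner_eval a) f)].
move=> [y1 y2] fy Py; apply/allpairsPdep; exists y2, y1; split=> //.
  exact: mem_roots_of p0 (pP _ fy Py).
by apply: mem_roots_of (curve_row_neq0 _) _; rewrite -ev2E.
Qed.

(** A Nullstellensatz for the curve. If [f] did not divide [P * Q], only finitely many heights would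
    occur on the curve, yet every height where [lead_coef f] is nonzero does. *)
Lemma curve_vanish_dvd P Q : ~ pdvd f Q ->
  (forall y, ev2 f y = 0 -> ev2 Q y != 0 -> ev2 P y = 0) -> pdvd f P.
Proof.
move=> nQ PQ; apply: contrapT => nP; have [_ _ fM] := curve_prime.
have [|p p0 pP] := @curve_bezout (P * Q); first by case/fM.
move/eqP: p0; apply; apply: (@poly_vanish_except _ _ (lead_coef f)).
  by rewrite lead_coef_eq0 -size_poly_gt0 ltnW.
move=> a la; have sa : size (map_poly (horner_eval a) f) = size f.
  exact: size_map_poly_id0.
have /closed_rootP[x /rootP fx] : size (map_poly (horner_eval a) f) != 1%N.
  by rewrite sa neq_ltn f_size orbT.
rewrite -ev2E in fx; apply: (pP (x, a)) => //.
rewrite ev2hE rmorphM -!ev2hE.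
by have [->|/PQ->] := eqVneq (ev2 Q (x, a)) 0; rewrite ?mulr0 ?mul0r.
Qed.

Let h y : C := ev2 H y.

Let hE y : h y = f1 f y ^+ 2 + f2 f y ^+ 2.
Proof. by rewrite /h /H ev2hE rmorphD !rmorphXn. Qed.

(** The derivative along the vector field [(f_2, - f_1)], which is tangent to the curve and
    annihilates [f]. *)
Definition tangential c : {poly {poly C}} := pd2 f * pd1 c - pd1 f * pd2 c.
Let W1 := tangential (pd1 f).
Let W2 := tangential (pd2 f).

(* [h ^ (-3/2) * M] is the curvature up to sign; [y + t grad f(y)] is a focal
   point of the curve exactly when [h + t M = 0]. *)
Let M := W1 * pd2 f - W2 * pd1 f.
Let m y : C := ev2 M y.

Lemma tangentialD a b : tangential (a + b) = tangential a + tangential b.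
Proof. by rewrite /tangential /pd1 derivD pd2D; ring. Qed.
Lemma tangentialM a b : tangential (a * b) = a * tangential b + b * tangential a.
Proof. by rewrite /tangential /pd1 derivM pd2M; ring. Qed.
Lemma tangentialC z : tangential z%:P%:P = 0.
Proof.
by rewrite /tangential /pd1 /pd2 map_polyC /= !derivC !mulr0 subr0.
Qed.

(** Differentiating the vanishing of [G] in [t] gives [E1], and along the curve gives [E2]. Off the
    focal points these two linear relations determine [A] and [B] from [E]. *)
Lemma normal_gradient G (y : C * C) (t : C) :
  (forall (q : C * C) (s : C), ev2 f q = 0 -> h q != 0 -> s != 0 ->
     ev3 G (q.1 + s * f1 f q, q.2 + s * f2 f q, s ^+ 2 * h q) = 0) ->
  ev2 f y = 0 -> h y != 0 -> t != 0 -> h y + t * m y != 0 ->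
  let X := (y.1 + t * f1 f y, y.2 + t * f2 f y, t ^+ 2 * h y) in
  ev3 (td1 G) X = - (2 * ev3 (td3 G) X) * (t * f1 f y) /\
  ev3 (td2 G) X = - (2 * ev3 (td3 G) X) * (t * f2 f y).
Proof.
move=> GP fy hy t0 nf X.
set A := ev3 (td1 G) X; set B := ev3 (td2 G) X; set E := ev3 (td3 G) X.
have E1 : A * f1 f y + B * f2 f y + E * (2 * t * h y) = 0.
  pose a1 : {poly C} := y.1%:P + 'X * (f1 f y)%:P.
  pose a2 : {poly C} := y.2%:P + 'X * (f2 f y)%:P.
  pose a3 : {poly C} := 'X ^+ 2 * (h y)%:P.
  have ev a b s : (a%:P + 'X * b%:P : {poly C}).[s] = a + s * b by rewrite !hornerE.
  have ev' s : a3.[s] = s ^+ 2 * h y by rewrite /a3 hornerM hornerXn hornerC.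
  (* The hypothesis leaves out [s = 0]; a polynomial vanishing at all other values is still zero. *)
  have PE : sub3 polyC a1 a2 a3 G = 0.
    apply: (@poly_vanish_except _ _ 'X); first by rewrite polyX_eq0.
    move=> s; rewrite hornerX => s0.
    rewrite -[LHS]/(horner_eval s _) phi_sub3 => [|z]; last exact: hornerC.
    by rewrite /= /horner_eval !ev ev' GP.
  have D1 z : horner_eval t z%:P = z by apply: hornerC.
  have D2 (a b : {poly C}) : (a + b)^`().[t] = a^`().[t] + b^`().[t].
    by rewrite derivD hornerD.
  have D3 (a b : {poly C}) :
      (a * b)^`().[t] = horner_eval t a * b^`().[t] + horner_eval t b * a^`().[t].
    by rewrite derivM hornerD !hornerM /horner_eval; ring.
  have D4 z : (z%:P)^`().[t] = 0 by rewrite derivC horner0.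
  have := @chain_rule C _ polyC (horner_eval t) (fun p => p^`().[t]) D1 D2 D3 D4 a1 a2 a3 G.
  rewrite PE deriv0 horner0 /= /horner_eval !ev ev' -/X -/A -/B -/E => cr.
  have dl a b : (a%:P + 'X * b%:P : {poly C})^`().[t] = b.
    by rewrite derivD derivM derivX !derivC !(hornerD, hornerM, hornerC) mulr0 addr0 add0r mul1r.
  have d3 : a3^`().[t] = 2 * t * h y.
    rewrite /a3 derivM derivXn derivC hornerD !hornerM hornerMn hornerXn hornerC horner0; ring.
  by rewrite [RHS]cr !dl d3.
have E2 : A * (f2 f y + t * ev2 W1 y) + B * (- f1 f y + t * ev2 W2 y)
          + E * (t ^+ 2 * (2 * (f1 f y * ev2 W1 y + f2 f y * ev2 W2 y))) = 0.
  pose T : {poly {poly C}} := t%:P%:P.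
  pose a1 : {poly {poly C}} := 'X + T * pd1 f.
  pose a2 : {poly {poly C}} := 'X%:P + T * pd2 f.
  pose a3 : {poly {poly C}} := T ^+ 2 * H.
  pose iota : {rmorphism C -> {poly {poly C}}} := polyC \o polyC.
  have Tq q : ev2 T q = t by rewrite /ev2 !hornerC.
  have Xq q : ev2 'X q = q.1 by rewrite /ev2 hornerX hornerC.
  have Yq q : ev2 'X%:P q = q.2 by rewrite /ev2 hornerC hornerX.
  have a1q q : ev2 a1 q = q.1 + t * f1 f q.
    by rewrite ev2hE rmorphD rmorphM -!ev2hE Tq Xq.
  have a2q q : ev2 a2 q = q.2 + t * f2 f q.
    by rewrite ev2hE rmorphD rmorphM -!ev2hE Tq Yq.
  have a3q q : ev2 a3 q = t ^+ 2 * h q.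
    by rewrite ev2hE rmorphM rmorphXn -!ev2hE Tq.
  have iotaq q z : ev2h q (iota z) = z by rewrite -ev2hE /ev2 !hornerC.
  (* Being [f * Q], the composite has zero tangential derivative at [y], since [f] and
     [tangential f] both vanish there. *)
  have [Q PE] : pdvd f (sub3 iota a1 a2 a3 G).
    apply: (curve_vanish_dvd f_ndvd) => q fq hq.
    by rewrite ev2hE phi_sub3 // -!ev2hE a1q a2q a3q GP.
  have D2 a b : ev2 (tangential (a + b)) y = ev2 (tangential a) y + ev2 (tangential b) y.
    by rewrite tangentialD ev2hE rmorphD.
  have D3 a b : ev2 (tangential (a * b)) y =
      ev2h y a * ev2 (tangential b) y + ev2h y b * ev2 (tangential a) y.
    by rewrite tangentialM ev2hE rmorphD !rmorphM.
  have D4 z : ev2 (tangential (iota z)) y = 0 by rewrite tangentialC ev2_0.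
  have := @chain_rule C _ iota (ev2h y) (fun c => ev2 (tangential c) y) (iotaq y) D2 D3 D4 a1 a2 a3 G.
  rewrite PE D3 -!ev2hE a1q a2q a3q -/X -/A -/B -/E fy mul0r add0r => cr.
  have tf : tangential f = 0 by rewrite /tangential mulrC subrr.
  have tT : ev2 (tangential T) y = 0 by apply: D4.
  have tX : tangential 'X = pd2 f.
    rewrite /tangential /pd1 derivX mulr1 [pd2 'X]pd2_swapXY swapXY_X derivC rmorph0.
    by rewrite mulr0 subr0.
  have tY : tangential 'X%:P = - pd1 f.
    rewrite /tangential /pd1 derivC mulr0 [pd2 _%:P]pd2_swapXY swapXY_Y derivX rmorph1.
    by rewrite mulr1 sub0r.
  have t1 : ev2 (tangential a1) y = f2 f y + t * ev2 W1 y.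
    by rewrite D2 D3 tT tX mulr0 addr0 -ev2hE Tq.
  have t2 : ev2 (tangential a2) y = - f1 f y + t * ev2 W2 y.
    by rewrite D2 D3 tT tY mulr0 addr0 -ev2hE Tq (ev2hE _ (- _)) rmorphN.
  have t3 : ev2 (tangential a3) y = t ^+ 2 * (2 * (f1 f y * ev2 W1 y + f2 f y * ev2 W2 y)).
    rewrite /a3 /H !expr2 !(D2, D3) tT -!ev2hE Tq -/(f1 f y) -/(f2 f y) -/W1 -/W2.
    rewrite !ev2hE !rmorphM -!ev2hE Tq; ring.
  by move: cr; rewrite tf ev2_0 mulr0 t1 t2 t3.
have mE : m y = ev2 W1 y * f2 f y - ev2 W2 y * f1 f y.
  by rewrite /m /M ev2hE rmorphB !rmorphM.
move: hy nf E1 E2; rewrite mE !hE.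
move: (f1 f y) (f2 f y) (ev2 W1 y) (ev2 W2 y) => n1 n2 w1 w2 hy nf E1 E2.
(* The combination of [E2] and [E1] below eliminates [E] and leaves [h + t m] times this
   difference. *)
have V0 : A * n2 - B * n1 = 0.
  apply: (mulfI nf); rewrite mulr0.
  transitivity ((n1 ^+ 2 + n2 ^+ 2) * 0 - t * (n1 * w1 + n2 * w2) * 0); last by ring.
  by rewrite -{1}E2 -E1; ring.
split; apply: (mulfI hy).
  transitivity (n1 * 0 + n2 * 0 - 2 * E * (t * n1) * (n1 ^+ 2 + n2 ^+ 2)); last by ring.
  by rewrite -{1}E1 -V0; ring.
transitivity (n2 * 0 - n1 * 0 - 2 * E * (t * n2) * (n1 ^+ 2 + n2 ^+ 2)); last by ring.
by rewrite -{1}E1 -V0; ring.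
Qed.


Lemma normal_offset_point (q : C * C) (s r : C) : ev2 f q = 0 -> h q != 0 -> r ^+ 2 = h q ->
  inOmega f q (q.1 + s * f1 f q, q.2 + s * f2 f q) (s * r) (h q)^-1.
Proof.
move=> fq hq rE; split; first exact: fq.
rewrite /bfun /nfun /wfun /= -hE (mulVf hq) subrr exprMn rE hE.
by split; [|split; [|by []]]; ring.
Qed.

(** The two square roots of [h q] realise the same point at opposite signs of [d]; adding and
    subtracting the two equations separates the parts. *)
Lemma even_odd_part_vanish g :
  (forall p, genOffsetProj f p -> ev3 g p = 0) ->
  forall (q : C * C) (s : C), ev2 f q = 0 -> h q != 0 -> s != 0 ->
  let X := (q.1 + s * f1 f q, q.2 + s * f2 f q, s ^+ 2 * h q) in
  ev3 (even_part g) X = 0 /\ ev3 (odd_part g) X = 0.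
Proof.
move=> gP q s fq hq s0 X.
have [r rE] : exists r, r ^+ 2 = h q by exists (sqrtC (h q)); rewrite sqrtCK.
have r0 : r != 0 by apply: contraNneq hq => r0; rewrite -rE r0 expr0n.
have van r' : r' ^+ 2 = h q -> ev3 (even_part g) X + s * r' * ev3 (odd_part g) X = 0.
  move=> r'E; rewrite /X -r'E -exprMn -ev3_even_odd; apply: gP.
  by exists q, (h q)^-1; apply: normal_offset_point.
have E1 := van _ rE; have E2 := van (- r) (etrans (sqrrN r) rE).
have two0 : 2 != 0 :> C by rewrite pnatr_eq0.
have odd0 : ev3 (odd_part g) X = 0.
  apply: (mulfI (mulf_neq0 two0 (mulf_neq0 s0 r0))); rewrite mulr0 -(subrr 0).
  by rewrite -{1}E1 -E2; ring.
by split=> //; rewrite -E1 odd0 mulr0 addr0.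
Qed.

(** No point of the line [x_2 = k] reached along a normal with squared distance [d ^+ 2] is a focal
    point. *)
Definition nonfocal (k d : C) : Prop := forall (y : C * C) (t : C), ev2 f y = 0 -> h y != 0 ->
  k = y.2 + t * f2 f y -> d ^+ 2 = t ^+ 2 * h y -> h y + t * m y != 0.

Lemma inOmega_normal (y x : C * C) (d u : C) : inOmega f y x d u -> f2 f y != 0 ->
  exists t, [/\ h y != 0, x.1 = y.1 + t * f1 f y, x.2 = y.2 + t * f2 f y &
                d ^+ 2 = t ^+ 2 * h y].
Proof.
rewrite /inOmega /bfun /nfun /wfun -hE => -[fy [b0 [n0 w0]]] f2y.
have hy : h y != 0.
  apply/eqP => h0; move/eqP: w0; rewrite h0 mulr0 sub0r oppr_eq0.
  by rewrite oner_eq0.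
exists ((x.2 - y.2) / f2 f y).
have x2E : x.2 = y.2 + (x.2 - y.2) / f2 f y * f2 f y by rewrite mulfVK // addrC subrK.
have x1E : x.1 = y.1 + (x.2 - y.2) / f2 f y * f1 f y.
  apply: (mulfI f2y).
  transitivity (f2 f y * y.1 + f1 f y * (x.2 - y.2) - 0); first by rewrite -n0; ring.
  by field.
split=> //; rewrite hE; move/eqP: b0; rewrite subr_eq0 => /eqP <-.
by rewrite {1}x1E {2}x2E; ring.
Qed.

(** The point is that [gam] involves [(x, k, d)] only and not the foot point [y]. *)
Lemma offset_gradient g (y : C * C) (x k d u : C) :
  (forall p, genOffsetProj f p -> ev3 g p = 0) -> nonfocal k d -> d != 0 ->
  inOmega f y (x, k) d u -> f2 f y != 0 ->
  let gam := - (2 * (ev3 (td3 (even_part g)) (x, k, d ^+ 2) +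
                     d * ev3 (td3 (odd_part g)) (x, k, d ^+ 2))) in
  ev3 (td1 g) (x, k, d) = gam * (x - y.1) /\ ev3 (td2 g) (x, k, d) = gam * (k - y.2).
Proof.
move=> gP nf d0 yO f2y; have [t [hy /= xE kE dE]] := inOmega_normal yO f2y.
have [fy _] := yO.
have t0 : t != 0.
  by apply: contraNneq d0 => t0; rewrite -sqrf_eq0 dE t0 expr0n mul0r.
have hy' := nf y t fy hy kE dE.
have ge q s fq hq s0 := (@even_odd_part_vanish g gP q s fq hq s0).1.
have go q s fq hq s0 := (@even_odd_part_vanish g gP q s fq hq s0).2.
have [] := normal_gradient ge fy hy t0 hy'; have [] := normal_gradient go fy hy t0 hy'.
rewrite -xE -kE -dE td1_even td1_odd td2_even td2_odd => o1 o2 e1 e2.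
have -> : x - y.1 = t * f1 f y by rewrite xE; ring.
have -> : k - y.2 = t * f2 f y by rewrite kE; ring.
rewrite (ev3_even_odd (td1 g)) (ev3_even_odd (td2 g)) o1 o2 e1 e2.
by split; ring.
Qed.

(** Both foot points satisfy the gradient relation with the same [gam], which is nonzero because the
    [x_1]-derivative is; cancelling it gives both coordinates. *)
Lemma foot_point_unique g (y y' : C * C) (x k d u u' : C) :
  (forall p, genOffsetProj f p -> ev3 g p = 0) -> nonfocal k d -> d != 0 ->
  ev3 (td1 g) (x, k, d) != 0 ->
  inOmega f y (x, k) d u -> f2 f y != 0 -> inOmega f y' (x, k) d u' -> f2 f y' != 0 ->
  y = y'.
Proof.
move=> gP nf d0 g1 yO f2y y'O f2y'.
have [] := offset_gradient gP nf d0 yO f2y.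
have [] := offset_gradient gP nf d0 y'O f2y'.
set gam := - _ => E1 E2 E3 E4.
have gam0 : gam != 0 by apply: contraNneq g1 => gam0; rewrite E1 gam0 mul0r.
move: E3 E4; rewrite E1 E2 => /(mulfI gam0)/addrI/oppr_inj E3 /(mulfI gam0)/addrI/oppr_inj E4.
by rewrite [y]surjective_pairing [y']surjective_pairing E3 E4.
Qed.

(** The failure of [nonfocal], written with equations to 0 so that it is visibly definable. *)
Definition focal (k d : C) : Prop := exists (y : C * C) (t : C),
  [/\ ev2 f y = 0, h y != 0, k - (y.2 + t * f2 f y) = 0,
      d ^+ 2 - t ^+ 2 * h y = 0 & h y + t * m y = 0].

Lemma definable_focal : definable (fun e : seq C => focal e`_1 e`_2).
Proof.
pose y (e : seq C) := (e`_3, e`_4).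
have : definable (fun e : seq C => ev2 f (y e) = 0 /\ ~ (h (y e) = 0) /\
    e`_1 - (e`_4 + e`_5 * f2 f (y e)) = 0 /\
    e`_2 ^+ 2 - e`_5 ^+ 2 * h (y e) = 0 /\ h (y e) + e`_5 * m (y e) = 0).
  do !apply: definable_and; try apply: definable_not; apply: definable_eq0;
  by do ![exact: polyfun_nth|exact: polyfun_ev2|apply: polyfunD|apply: polyfunN
    |apply: polyfunM|apply: polyfunX|apply: polyfun_ev2].
move=> /(definable_ex 5)/(definable_ex 4)/(definable_ex 3); apply: definable_ext => e.
rewrite /y; split=> [[y1 [y2 [t]]]|[[y1 y2] [t [fy /eqP hy kE dE mE]]]].
  do 3!rewrite ?nth_set_nth /=; move=> [fy [hy [kE [dE mE]]]]; exists (y1, y2), t.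
  exact: And5 fy (introN eqP hy) kE dE mE.
exists y1, y2, t; do 3!rewrite ?nth_set_nth /=.
exact: (conj fy (conj hy (conj kE (conj dE mE)))).
Qed.

(* Along a generic line [y_2 = k] the focal condition leaves finitely many [y],
   hence finitely many values of [d]. *)
Lemma gen2_nonfocal : gen2 nonfocal.
Proof.
have [|] := definable_gen2 definable_focal; last first.
  apply: gen2W => k d nfoc y t fy hy kE dE; apply/eqP => foc; apply: nfoc.
  by exists y, t; rewrite kE dE !subrr.
move=> [c c0 cP]; exfalso.
(* Multiplying [h + t m] by [f_2] and substituting [t f_2 = k - y_2] eliminates [t]. *)
pose Pk k : {poly {poly C}} := pd2 f * H + (k%:P%:P - 'X%:P) * M.
(* One of two admissible values of [k] works: if [f] divided both [Pk], it would divide their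
   difference, hence [M], hence [pd2 f * H], against primality. *)
have [k ck nPk] : exists2 k, c.[k%:P] != 0 & ~ pdvd f (Pk k).
  have [k1 [d1 cd1]] := poly2_nonroot c0.
  have q0 : map_poly (horner_eval d1) c != 0.
    by apply: contraNneq cd1 => q0; rewrite ev2E q0 horner0.
  have nk k : (map_poly (horner_eval d1) c).[k] != 0 -> c.[k%:P] != 0.
    by rewrite -ev2E; apply: contraNneq => ck; rewrite /ev2 ck horner0.
  have ck1 : c.[k1%:P] != 0 by apply: nk; rewrite -ev2E.
  have [k2] : exists k2, (map_poly (horner_eval d1) c * ('X - k1%:P)).[k2] != 0.
    by apply: poly_nonroot; rewrite mulf_neq0 // polyXsubC_eq0.
  rewrite hornerM hornerXsubC mulf_eq0 negb_or subr_eq0 => /andP[/nk ck2 k12].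
  have [f1k|] := EM (pdvd f (Pk k1)); last by exists k1.
  have [f2k|] := EM (pdvd f (Pk k2)); last by exists k2.
  exfalso; have [_ _ fM] := curve_prime.
  have k21 : k2 - k1 != 0 by rewrite subr_eq0.
  have fdM : pdvd f M.
    have : pdvd f ((k2 - k1)^-1%:P%:P * (Pk k2 - Pk k1)).
      exact/pdvd_mull/pdvdB.
    rewrite (_ : Pk k2 - Pk k1 = (k2 - k1)%:P%:P * M); last first.
      by rewrite /Pk !polyCB; ring.
    by rewrite mulrA -!polyCM mulVf // mul1r.
  have : pdvd f (pd2 f * H).
    rewrite (_ : _ * H = Pk k1 - (k1%:P%:P - 'X%:P) * M); last by rewrite /Pk; ring.
    by apply: pdvdB => //; apply: pdvd_mull.
  by case/fM; [apply: curve_not_dvd_pd2|].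
have [s sP] := curve_finite nPk.
(* Eliminating [t] between [d ^+ 2 = t ^+ 2 * h] and [h + t m = 0] gives [d ^+ 2 * m ^+ 2 = h ^+ 3].
   The guard [h y != 0] makes [B] nonzero at 0. *)
pose B : {poly C} := \prod_(y <- s | h y != 0) ('X ^+ 2 * (m y ^+ 2)%:P - (h y ^+ 3)%:P).
have B0 : B != 0.
  apply: contraTneq isT => B0; have : B.[0] == 0 by rewrite B0 horner0.
  rewrite horner_prod prodf_seq_eq0 => /hasP[y _ /andP[hy]].
  rewrite hornerD hornerN hornerM hornerXn !hornerC expr0n mul0r sub0r oppr_eq0.
  by rewrite expf_eq0 (negPf hy).
suff /eqP : B = 0 by rewrite (negPf B0).
(* For this [k], every [d] that is not a root of [c.[k%:P]] is a root of [B]. *)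
apply: (poly_vanish_except ck) => d /(cP k d)[y [t [fy hy kE dE foc]]].
have ys : y \in s.
  apply: sP => //; rewrite ev2hE rmorphD !rmorphM rmorphB -!ev2hE.
  rewrite [ev2 k%:P%:P y](_ : _ = k); last by rewrite /ev2 !hornerC.
  rewrite [ev2 'X%:P y](_ : _ = y.2); last by rewrite /ev2 hornerC hornerX.
  rewrite -/(f2 f y) -/(h y) -/(m y).
  transitivity (f2 f y * (h y + t * m y) + (k - (y.2 + t * f2 f y)) * m y).
    by ring.
  by rewrite foc kE mulr0 mul0r addr0.
apply/eqP; rewrite horner_prod prodf_seq_eq0; apply/hasP; exists y => //.
rewrite hy /= hornerD hornerN hornerM hornerXn !hornerC; apply/eqP.
move: dE foc; move: (h y) (m y) => a b /eqP.
rewrite subr_eq0 => /eqP-> /eqP; rewrite addr_eq0 => /eqP->.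
ring.
Qed.

End Curve.

(** * Solutions over a generic line *)

Section Assembly.
Variable C : numClosedFieldType.

Lemma ev3_specialize (G : {poly {poly {poly C}}}) (x k d : C) :
  ev3 G (x, k, d) = ev2 (map_poly (map_poly (horner_eval d)) G) (x, k).
Proof.
elim/poly_ind: G => [|G c IHG]; first by rewrite map_poly0 ev3_0 ev2_0.
by rewrite map_polyMXaddC ev3MXaddC ev2MXaddC IHG [ev2 c _]ev2E.
Qed.

Variables (f : {poly {poly C}}) (g : {poly {poly {poly C}}}).
Hypothesis f_irr : irreducible2 f.
Hypothesis f_not_line : curve_not_line f.
Hypothesis f_ndvd : ~ pdvd f (pd1 f ^+ 2 + pd2 f ^+ 2).
Hypothesis g_off : generic_offset_eq f g.

Lemma generic_offset_vanish p : genOffsetProj f p -> ev3 g p = 0.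
Proof. by move=> pP; apply/g_off.1 => h; apply. Qed.

(** With [d] fixed, [g] is one of the bivariate polynomials tested by the closure in the plane. *)
Lemma offset_vanish (x : C * C) (d : C) : offset f d x -> ev3 g (x.1, x.2, d) = 0.
Proof.
rewrite ev3_specialize -surjective_pairing; apply=> -[x1 x2] [y [u yO]].
by rewrite -ev3_specialize; apply: generic_offset_vanish; exists y, u.
Qed.

Lemma gen2_no_ramification :
  gen2 (fun k _ => forall y, ev2 f y = 0 -> y.2 = k -> f2 f y != 0).
Proof.
have [p p0 pP] := curve_bezout f_irr f_not_line (curve_not_dvd_pd2 f_irr f_not_line).
exists (map_poly polyC p); first by rewrite map_poly_eq0_id0 // ?polyC_eq0 lead_coef_eq0.
move=> k d ck y fy yk; apply: contraNneq ck => f2y.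
rewrite ev2E -map_poly_comp map_poly_id => [|z _]; last exact: hornerC.
by rewrite -yk pP.
Qed.

(** If [f_2] vanishes, the normal equation leaves [f_1 = 0], excluded by [w], or a ramification
    point at the height of [x]. *)
Lemma solution_unramified (y x : C * C) (d u : C) : inOmega f y x d u ->
  (ev2 f y = 0 -> y.2 = x.2 -> f2 f y != 0) -> f2 f y != 0.
Proof.
rewrite /inOmega /bfun /nfun /wfun => -[fy [_ [n0 w0]]] ram.
apply/negP => /eqP f20; have /eqP := n0.
rewrite f20 oppr0 mul0r add0r mulf_eq0 => /orP[/eqP f10|].
  by move/eqP: w0; rewrite f10 f20 expr0n addr0 mulr0 sub0r oppr_eq0 oner_eq0.
rewrite subr_eq0 => /eqP xy; have := ram fy (esym xy).
by rewrite f20 eqxx.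
Qed.

(** With [k = x_2], [s] equals [f_2 ^+ 2 * b] plus [n] times [f_1 (x_2 - y_2) + f_2 (x_1 - y_1)]. *)
Lemma solution_sfun (y x : C * C) (d u : C) : inOmega f y x d u -> sfun f y d x.2 = 0.
Proof.
rewrite /inOmega /bfun /nfun /sfun => -[_ [b0 [n0 _]]].
move: (f1 f y) (f2 f y) b0 n0 => n1 n2 b0 n0.
transitivity (n2 ^+ 2 * 0 + 0 * (n1 * (x.2 - y.2) + n2 * (x.1 - y.1))); last by ring.
by rewrite -{1}b0 -n0; ring.
Qed.

(** The normal equation is solved for [x_1]. The value of [u] exists because a zero of [h] would
    reduce [s] to [- f_2 ^+ 2 * d ^+ 2]. *)
Lemma solution_exists (y : C * C) (k d : C) : ev2 f y = 0 -> d != 0 ->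
  sfun f y d k = 0 -> f2 f y != 0 -> exists x u, inOmega f y (x, k) d u.
Proof.
rewrite /inOmega /bfun /nfun /wfun /sfun => fy d0.
move: (f1 f y) (f2 f y) => n1 n2 s0 n20.
have h0 : n1 ^+ 2 + n2 ^+ 2 != 0.
  apply/eqP => h0; move/eqP: s0; rewrite h0 mul0r sub0r oppr_eq0 mulf_eq0 !sqrf_eq0.
  by rewrite (negPf n20) (negPf d0).
exists (y.1 + n1 * (k - y.2) / n2), (n1 ^+ 2 + n2 ^+ 2)^-1.
split; first exact: fy.
rewrite /= (mulVf h0) subrr; split; last by split; [field|].
apply: (mulfI (expf_neq0 2 n20)); rewrite mulr0 -s0.
by field.
Qed.

Lemma generic_line_offset :
  exists Delta : C * C -> Prop,
    zopen2 Delta /\ (exists p, Delta p) /\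
    forall d0 k0 : C, Delta (d0, k0) ->
      exists Gamma : seq ((C * C) * (C * C) * C),
        size Gamma = (size g).-1 /\
        (forall t, t \in Gamma -> solS2 f d0 k0 t.1.1 t.1.2 t.2) /\
        uniq [seq t.1.2 | t <- Gamma] /\
        (forall x : C * C,
            (x.2 = k0 /\ offset f d0 x) <-> x \in [seq t.1.2 | t <- Gamma]) /\
        uniq [seq t.1.1 | t <- Gamma] /\
        (forall t, t \in Gamma -> regular_pt f t.1.1 /\ ~ ramification f t.1.1) /\
        (forall y : C * C, ev2 f y = 0 -> y.2 = k0 -> ~ ramification f y) /\
        (forall t, t \in Gamma -> ev2 f t.1.1 = 0 /\ sfun f t.1.1 d0 k0 = 0) /\
        (forall p : C * C, ev2 f p = 0 -> sfun f p d0 k0 = 0 ->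
            ~ ramification f p ->
            exists (q : C * C) (u0 : C), (p, q, u0) \in Gamma).
Proof.
have g0 := generic_offset_eq_neq0 g_off; have [_ [sqf _]] := g_off.
have gen_d : gen2 (fun _ d : C => d != 0).
  exists 'X%:P; first by rewrite polyC_eq0 polyX_eq0.
  by move=> k d; rewrite /ev2 hornerC hornerX.
have [c c0 cP] := gen2I gen_d (gen2I gen2_no_ramification
  (gen2I (gen2_simple_roots g0 sqf)
    (gen2I (gen2_offset_fibre g_off) (gen2_nonfocal f_irr f_not_line f_ndvd)))).
(* Genericity is expressed in [(k, d)], whereas [Delta] takes pairs [(d, k)]. *)
exists (fun p => ev2 (swapXY c) p != 0); split.
  exists [:: swapXY c] => p; split=> [cp|[h]]; last by rewrite inE => /eqP->.
  by exists (swapXY c); rewrite ?mem_head.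
split; first by have [k [d ckd]] := poly2_nonroot c0; exists (d, k); rewrite ev2_swapXY.
move=> d k; rewrite ev2_swapXY => /cP[d0 [ram [[simp [rs [rsU rsS rsP]]] [fib nf]]]].
have nram y : ev2 f y = 0 -> y.2 = k -> ~ ramification f y.
  by move=> fy yk [_ f20]; have := ram y fy yk; rewrite f20 eqxx.
have f2O y x u : inOmega f y (x, k) d u -> f2 f y != 0.
  by move=> yO; apply: (solution_unramified yO) => fy yk; apply: ram.
have /choice[F FP] : forall x, exists z : (C * C) * C,
    x \in rs -> inOmega f z.1 (x, k) d z.2.
  move=> x; have [xrs|_] := boolP (x \in rs); last by exists (0, 0, 0).
  by have /fib[y [u yO]] := (rsP x).1 xrs; exists (y, u).
(* For a fixed foot point, the normal equation is affine in [x_1] with slope [- f_2], which is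
   nonzero. *)
have Finj : {in rs &, injective (fun x => (F x).1)}.
  move=> x x' xrs x'rs /= E; have xO := FP _ xrs; have x'O := FP _ x'rs.
  have nz := f2O _ _ _ xO; move: xO x'O nz; rewrite -E.
  rewrite /inOmega /nfun /= => -[_ [_ [n1 _]]] [_ [_ [n2 _]]] nz.
  by apply: (mulfI nz); apply/eqP; rewrite -subr_eq0 -(subrr 0) -{1}n2 -n1; apply/eqP; ring.
pose sol x := ((F x).1, (x, k), (F x).2).
exists [seq sol x | x <- rs].
have solP t : t \in [seq sol x | x <- rs] -> exists2 x, x \in rs & t = sol x.
  by move=> /mapP.
split; first by rewrite size_map rsS.
split.
  move=> _ /solP[x xrs ->]; have := FP _ xrs.
  by rewrite /solS2 /inOmega /= subrr => -[fy [b0 [n0 w0]]].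
split.
  by rewrite -map_comp map_inj_uniq // => x x' [].
split.
  move=> x; rewrite -map_comp; split=> [[xk /offset_vanish]|/mapP[x1 xrs ->]].
    rewrite xk => /rsP xrs; apply/mapP; exists x.1 => //=.
    by rewrite -xk -surjective_pairing.
  by split=> // h; apply; exists (F x1).1, (F x1).2; apply: FP.
split; first by rewrite -map_comp map_inj_in_uniq.
split.
  move=> _ /solP[x xrs ->] /=; have xO := FP _ xrs; have f2x := f2O _ _ _ xO.
  have [fy _] := xO.
  split; first by split=> //; right.
  by move=> [_ f20]; rewrite f20 eqxx in f2x.
split; first exact: nram.
split.
  move=> _ /solP[x xrs ->] /=; have xO := FP _ xrs.
  by have [fy _] := xO; split=> //; apply: (solution_sfun xO).
move=> p fp sp pram.
have f2p : f2 f p != 0 by apply/eqP => f20; apply: pram.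
have [x [u pO]] := solution_exists fp d0 sp f2p.
have gx : ev3 g (x, k, d) = 0 by apply/fib; exists p, u.
have xrs : x \in rs by apply/rsP.
(* It remains to see that the foot point chosen over [x] is [p] itself; this is uniqueness. *)
exists (x, k), (F x).2; apply/mapP; exists x => //.
rewrite /sol; congr (_, _, _).
have xO := FP _ xrs.
exact: (foot_point_unique f_irr f_not_line f_ndvd generic_offset_vanish nf d0
  (simp _ gx) pO f2p xO (f2O _ _ _ xO)).
Qed.

End Assembly.

Theorem mainTheorem4 (R : realType) (f : {poly {poly R[i]}})
  (g : {poly {poly {poly R[i]}}}) :
  irreducible2 f -> curve_not_line f ->
  ~ pdvd f (pd1 f ^+ 2 + pd2 f ^+ 2) ->
  generic_offset_eq f g ->
  exists Delta : R[i] * R[i] -> Prop,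
    zopen2 Delta /\ (exists p, Delta p) /\
    forall d0 k0 : R[i], Delta (d0, k0) ->
      exists Gamma : seq ((R[i] * R[i]) * (R[i] * R[i]) * R[i]),
        size Gamma = (size g).-1 /\
        (forall t, t \in Gamma -> solS2 f d0 k0 t.1.1 t.1.2 t.2) /\
        uniq [seq t.1.2 | t <- Gamma] /\
        (forall x : R[i] * R[i],
            (x.2 = k0 /\ offset f d0 x) <-> x \in [seq t.1.2 | t <- Gamma]) /\
        uniq [seq t.1.1 | t <- Gamma] /\
        (forall t, t \in Gamma -> regular_pt f t.1.1 /\ ~ ramification f t.1.1) /\
        (forall y : R[i] * R[i], ev2 f y = 0 -> y.2 = k0 -> ~ ramification f y) /\
        (forall t, t \in Gamma -> ev2 f t.1.1 = 0 /\ sfun f t.1.1 d0 k0 = 0) /\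
        (forall p : R[i] * R[i], ev2 f p = 0 -> sfun f p d0 k0 = 0 ->
            ~ ramification f p ->
            exists (q : R[i] * R[i]) (u0 : R[i]), (p, q, u0) \in Gamma).
Proof. exact: generic_line_offset. Qed.
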